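(* Let $\mathcal{G}$ be a family of finite nilpotent groups of bounded exponent and bounded nilpotency class (there are constants $m$ and $c$ such that every $G\in\mathcal{G}$ has exponent at most $m$ and nilpotency class at most $c$). Then STPP constructions in the family $\mathcal{G}$ cannot achieve $\omega=2$; that is, there is a real number $\tau$ with $2<\tau\le 3$ such that for every $G\in\mathcal{G}$ and every STPP construction $(S_i,T_i,U_i)_i$ in $G$, $$\sum_i (|S_i||T_i||U_i|)^{\tau/3}\le \sum_j d_j^{\tau},$$ where the $d_j$ are the dimensions of the irreducible complex representations of $G$.
   Context: An STPP construction in a finite group $G$ is a finite collection of triples of subsets $S_i,T_i,U_i\subseteq G$ satisfying the simultaneous triple product property: (1) for each $i$ and all $s,s'\in S_i$, $t,t'\in T_i$, $u,u'\in U_i$, if $s^{-1}s't^{-1}t'u^{-1}u'=1$ then $s=s'$, $t=t'$, $u=u'$; (2) for all $i,j,k$ and all $s\in S_i$, $s'\in S_j$, $t\in T_j$, $t'\in T_k$, $u\in U_k$, $u'\in U_i$, if $s^{-1}s't^{-1}t'u^{-1}u'=1$ then $i=j=k$. It is known that every STPP construction satisfies $\sum_i(|S_i||T_i||U_i|)^{\omega/3}\le\sum_j d_j^{\omega}$, where $\omega$ is the exponent of matrix multiplication and the $d_j$ are the dimensions of the irreducible complex representations of $G$. ''STPP constructions in a family cannot achieve $\omega=2$'' means that these inequalities, for all STPP constructions in groups of the family, do not imply $\omega=2$: some real $\tau\in(2,3]$ in place of $\omega$ is consistent with all of them. *)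

(* Defs.v *)
From HB Require Import structures.
From mathcomp Require Import all_boot all_order all_algebra all_fingroup.
From mathcomp Require Import all_solvable all_field all_character.
From mathcomp Require Import all_classical all_reals all_analysis.

Set Implicit Arguments.
Unset Strict Implicit.
Unset Printing Implicit Defensive.

Import GroupScope.

Record STPP (gT : finGroupType) (G : {group gT}) (I : finType)
    (S T U : I -> {set gT}) : Prop := MkSTPP {
  STPP_subset : forall i, [/\ S i \subset G, T i \subset G & U i \subset G];
  STPP_triple : forall i s s' t t' u u',
    s \in S i -> s' \in S i -> t \in T i -> t' \in T i ->
    u \in U i -> u' \in U i ->
    s^-1 * s' * t^-1 * t' * u^-1 * u' = 1 ->
    [/\ s = s', t = t' & u = u'];
  STPP_simultaneous : forall i j k s s' t t' u u',
    s \in S i -> s' \in S j -> t \in T j -> t' \in T k ->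
    u \in U k -> u' \in U i ->
    s^-1 * s' * t^-1 * t' * u^-1 * u' = 1 ->
    i = j /\ j = k }.

(* The dimension, as a natural number, of the irreducible representation
   'Chi_i affording 'chi_i. Its base field algC is the algebraic closure of
   the rationals in the complex numbers, over which every complex
   representation of a finite group is realizable. *)
Definition irr_dim (gT : finGroupType) (G : {group gT}) (i : Iirr G) : nat :=
  irr_degree (socle_of_Iirr i).

(* Main.v *)
(* It suffices to find eps > 0, depending only on m and c, such that
   sum_i (|S_i||T_i||U_i|)^(2/3) <= |G|^(1 - eps) for every STPP construction:
   as |S_i||T_i||U_i| <= |G|^3 and |G| = sum_j d_j^2 <= sum_j d_j^tau, the
   exponent tau = 2 + eps then works.

   Upper bound. Write G = P x Q with P the largest Sylow subgroup, so that |P|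
   is at least |G|^(1/m), and let p be its prime. The lower exponent-p-central
   series Lam_0 = P >= Lam_1 >= ... >= Lam_L = 1 has length L bounded in terms
   of m and c. Give h - 1 the weight p^l for h in Lam_l. As
   p^l + p^l' <= p^(1 + max(l, l')), commutators respect these weights, and so
   do p-th powers; hence adjoining the elements of a chief series one at a time
   straightens every product, and F_p[P] gets a filtration U by ideals spanned
   by ordered monomials prod_s (g_s - 1)^(e_s) with e_s < p. The top weight is
   D = sum_s (p - 1) w_s, so W = U(k) F_p[Q] with k > D / 3 satisfies W^3 = 0.
   The average weight of a monomial is D / 2, so by a Chernoff bound W has
   codimension at most |G| times a factor exponentially small in log |P|.

   Lower bound. An STPP construction with L blocks of side n embeds a direct sum
   of L matrix multiplications of size n in the group algebra. Grading the
   matrices by their diagonals turns W^3 = 0 into the vanishing of pointwise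
   products u v w on spaces of vectors, which forces the codimension of W to be
   at least L n^2 / 27.

   The general case follows by sorting the blocks according to the dyadic sizes
   of their sides, making them square with three cyclic permutations of the
   construction in G^3, and removing the polylogarithmic loss by passing to
   G^(2^k). *)

Require Import Defs.
From HB Require Import structures.
From mathcomp Require Import all_boot all_order all_algebra all_fingroup.
From mathcomp Require Import all_solvable all_field all_character.
From mathcomp Require Import all_classical all_reals all_analysis.
From mathcomp Require Import zify ring lra.

Set Implicit Arguments.
Unset Strict Implicit.
Unset Printing Implicit Defensive.

Import Order.TTheory GRing.Theory Num.Theory.
(* [all_classical] shadows [subsetP], [setX], ... for finite sets. *)
Import mathcomp.boot.fintype mathcomp.boot.finset.
Local Open Scope ring_scope.

(** * Filtrations of group algebras of p-groups *)

Section Layered.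

Local Open Scope group_scope.

(** A central series with factors of exponent dividing p, stated elementwise, a form that passes
    directly to products of groups. *)
Record layered (p L : nat) (gT : finGroupType) (P : {group gT})
    (Lam : nat -> {group gT}) : Prop := Layered {
  layered0 : Lam 0%N = P;
  layeredL : Lam L \subset [1];
  layeredS : forall l, Lam l.+1 \subset Lam l;
  layeredR : forall l x y, x \in Lam l -> y \in P -> [~ x, y] \in Lam l.+1;
  layeredX : forall l x, x \in Lam l -> x ^+ p \in Lam l.+1 }.

Lemma layered_leq p L gT (P : {group gT}) Lam : layered p L P Lam ->
  forall l l', (l <= l')%N -> Lam l' \subset Lam l.
Proof.
case=> _ _ LamS _ _ l l' /subnK <-; elim: (l' - l)%N => // k IHk.
by rewrite addSn (subset_trans (LamS _)).
Qed.

End Layered.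

(* The number of exponent vectors [e] with all [e_i < p] and [sum w_i e_i < k];
   once the weight reaches [k], the subtraction truncates to [0] and the count
   vanishes. *)
Fixpoint count_lt (p : nat) (ws : seq nat) (k : nat) : nat :=
  if ws is w :: ws' then (\sum_(e < p) count_lt p ws' (k - e * w))%N
  else (0 < k)%N.

Section Filtration.

Variables (F : fieldType) (A : falgType F) (p L : nat).
Hypothesis charAp : p \in [pchar A].
Variables (gT : finGroupType) (rho : gT -> A).
Hypothesis rho1 : rho 1%g = 1.
Hypothesis rhoM : forall x y, rho (x * y)%g = rho x * rho y.
Variables (P : {group gT}) (Lam : nat -> {group gT}).
Hypothesis layP : layered p L P Lam.

Let p_gt1 : (1 < p)%N. Proof. by rewrite prime_gt1 ?(pcharf_prime charAp). Qed.
Let p_gt0 : (0 < p)%N. Proof. exact: ltnW. Qed.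

(** The invariant kept while H climbs from 1 to P. [ws] lists the weights of the elements adjoined
    so far, and [U k] stands for the span of the ordered monomials of weight at least k. Alignment
    places H between consecutive layers. The monomials may be dependent in A, so codimensions are
    only bounded from above. *)
Record filtered (H : {group gT}) (ws : seq nat) (U : nat -> {vspace A}) : Prop :=
  Filtered {
  filtered_sub : H \subset P;
  filtered_aligned : forall l, (Lam l \subset H) \/ (H \subset Lam l);
  filtered_card : #|H| = (p ^ size ws)%N;
  filtered_ws : {in ws, forall w, (0 < w)%N && (w * p <= p ^ L)%N};
  filtered_le : forall k l, (k <= l)%N -> (U l <= U k)%VS;
  filtered_rho : {in H, forall h, rho h \in U 0%N};
  filtered_comm : forall y, {in H, forall h, GRing.comm (rho h) (rho y)} ->
    {in U 0%N, forall v, GRing.comm v (rho y)};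
  filtered_mul : forall k l u v, u \in U k -> v \in U l -> u * v \in U (k + l)%N;
  filtered_gen : forall l h, h \in H -> h \in Lam l -> rho h - 1 \in U (p ^ l)%N;
  filtered_conj : forall l y k v, y \in Lam l -> v \in U k ->
    rho y^-1%g * v * rho y - v \in U (k + p ^ l)%N;
  filtered_top : forall k, (\sum_(w <- ws) w * p.-1 < k)%N -> (U k <= 0)%VS;
  filtered_codim : forall k, exists2 C, (U 0%N <= U k + C)%VS
    & (\dim C <= count_lt p ws k)%N }.

Lemma rhoV x : rho x^-1%g * rho x = 1.
Proof. by rewrite -rhoM mulVg rho1. Qed.

Lemma rhoVr x : rho x * rho x^-1%g = 1.
Proof. by rewrite -rhoM mulgV rho1. Qed.

Lemma filtered1 : filtered 1%G [::] (fun k => if k is 0%N then 1%VS else 0%VS).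
Proof.
have U0P (v : A) : v \in 1%VS -> exists c, v = c%:A by case/vlineP=> c ->; exists c.
split.
- by rewrite sub1G.
- by move=> l; right; rewrite sub1G.
- by rewrite cards1.
- by [].
- by case=> [|k] [|l] // _; rewrite ?sub0v ?subvv.
- by move=> h /set1P ->; rewrite rho1 memv_line.
- by move=> y _ v /U0P[c ->]; rewrite /GRing.comm -scalerAl -scalerAr mul1r mulr1.
- move=> [|k] [|l] u v /=.
  + by move=> /U0P[c ->] /U0P[d ->]; rewrite -scalerAl mul1r scalerA memvZ ?memv_line.
  + by rewrite memv0 => _ /eqP ->; rewrite mulr0 mem0v.
  + by rewrite memv0 => /eqP -> _; rewrite mul0r mem0v.
  + by rewrite memv0 => /eqP -> _; rewrite mul0r mem0v.
- by move=> l h /set1P -> _; rewrite rho1 subrr mem0v.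
- move=> l y [|k] v _ /=.
    by move=> /U0P[c ->]; rewrite -scalerAr mulr1 -scalerAl rhoV subrr mem0v.
  by rewrite memv0 => /eqP ->; rewrite mulr0 mul0r subrr mem0v.
- by move=> [|k] //=; rewrite big_nil.
- move=> [|k]; first by exists 0%VS; rewrite ?addv0 ?subvv ?dimv0.
  by exists 1%VS; rewrite ?add0v ?subvv //= dimv1.
Qed.

(** The least index whose layer lies in H is positive, since [Lam 0] is P. Its predecessor is the
    layer that supplies the next element. *)
Lemma aligned_gap (H : {group gT}) : H \subset P ->
  (forall l, (Lam l \subset H) \/ (H \subset Lam l)) ->
  ~~ (P \subset H) -> exists l, [/\ (l < L)%N, H \subset Lam l, ~~ (Lam l \subset H) &
    Lam l.+1 \subset H].
Proof.
move=> sHP alH nPH; have [Lam0 LamL LamS _ _] := layP.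
have exl : exists l, Lam l \subset H by exists L; rewrite (subset_trans LamL) ?sub1G.
pose l0 := ex_minn exl; have [sl0 minl0] :
    Lam l0 \subset H /\ forall l, Lam l \subset H -> (l0 <= l)%N.
  by rewrite /l0; case: ex_minnP.
case: l0 => [|l] in sl0 minl0; first by rewrite -Lam0 sl0 in nPH.
have nl : ~~ (Lam l \subset H) by apply/negP => /minl0; rewrite ltnn.
exists l; split=> //; last by case: (alH l) => // s; rewrite s in nl.
by apply: minl0; rewrite (subset_trans LamL) ?sub1G.
Qed.

(** * Adjoining one element of a layer to the subgroup *)

Section Step.

Variables (H : {group gT}) (ws : seq nat) (U : nat -> {vspace A}).
Hypothesis filtU : filtered H ws U.
Variables (l0 : nat) (g : gT).
Hypothesis l0L : (l0 < L)%N.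
Hypothesis sHl0 : H \subset Lam l0.
Hypothesis sl0H : Lam l0.+1 \subset H.
Hypothesis gLam : g \in Lam l0.
Hypothesis gH : g \notin H.

Local Notation w := (p ^ l0)%N.
Local Notation x := (rho g - 1).
Local Notation H' := (<[g]> <*> H)%G.

(** Monomials with a power of x in front. The truncated subtraction yields [U 0] once x ^+ e alone
    carries the required weight. *)
Definition adjoin_filtration k : {vspace A} :=
  (\sum_(e < p) (amull (x ^+ e) @: U (k - e * w)))%VS.
Local Notation U' := adjoin_filtration.

Lemma adjoin_filtrationP k (Z : {vspace A}) :
  (forall e u, (e < p)%N -> u \in U (k - e * w)%N -> x ^+ e * u \in Z) ->
  (U' k <= Z)%VS.
Proof.
move=> h; apply/subv_sumP => e _; apply/subvP => _ /memv_imgP[u Uu ->].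
by rewrite lfunE; apply: h.
Qed.

Lemma adjoin_filtration_mem k e u :
  (e < p)%N -> u \in U (k - e * w)%N -> x ^+ e * u \in U' k.
Proof.
move=> lt_ep Uu; apply: (subvP (sumv_sup (Ordinal lt_ep) _ (subvv _))) => //=.
by apply/memv_imgP; exists u; rewrite ?lfunE.
Qed.

Lemma sub_adjoin_filtration k : (U k <= U' k)%VS.
Proof.
apply/subvP=> u Uu; rewrite -[u]mul1r -(expr0 x).
by apply: adjoin_filtration_mem; rewrite ?mul0n ?subn0.
Qed.

Lemma adjoin_filtration_le k l : (k <= l)%N -> (U' l <= U' k)%VS.
Proof.
move=> le_kl; apply: adjoin_filtrationP => e u lt_ep Uu.
apply: adjoin_filtration_mem => //; apply: (subvP (filtered_le filtU _)) Uu.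
exact: leq_sub2r.
Qed.

Lemma genP : g \in P.
Proof.
by rewrite -(layered0 layP); apply: (subsetP (layered_leq layP (leq0n l0))).
Qed.

Lemma layP0 l y : y \in Lam l -> y \in P.
Proof. by rewrite -(layered0 layP); apply/subsetP/(layered_leq layP). Qed.

Lemma gen_norm : g \in 'N(H)%g.
Proof.
apply/normP/eqP; rewrite eqEcard cardJg leqnn andbT.
apply/subsetP => _ /imsetP[h Hh ->]; rewrite conjg_mulR groupM //.
apply: (subsetP sl0H); apply: (layeredR layP); rewrite ?genP //.
exact: (subsetP sHl0).
Qed.

Lemma genXp : (g ^+ p)%g \in H.
Proof. by apply: (subsetP sl0H); apply: layeredX layP _ _ _. Qed.

Lemma rhoX n : rho (g ^+ n)%g = rho g ^+ n.
Proof. by elim: n => [|n IHn]; rewrite ?rho1 // expgS rhoM IHn exprS. Qed.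

(** In characteristic p, (g - 1)^p = g^p - 1, and g^p lies one layer deeper; this is why weights
    grow by a factor p per layer. *)
Lemma gen_powp : x ^+ p \in U (p * w)%N.
Proof.
have -> : x ^+ p = rho (g ^+ p)%g - 1.
  rewrite rhoX -!(pFrobenius_autE charAp) pFrobenius_autB_comm ?pFrobenius_aut1 //.
  exact: commr1.
rewrite -expnS; apply: (filtered_gen filtU); rewrite ?genXp //.
exact: layeredX layP _ _ _.
Qed.

(** Only the exponent e = p - 1 overflows; then [gen_powp] trades x ^+ p for an element of H's
    filtration without loss of weight. *)
Lemma adjoin_filtration_mulx k v : v \in U' k -> x * v \in U' (k + w)%N.
Proof.
move=> U'v; have: (amull x @: U' k <= U' (k + w)%N)%VS.
  rewrite limg_sum; apply/subv_sumP => e _; apply/subvP => z.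
  move=> /memv_imgP[_ /memv_imgP[u Uu ->] ->]; rewrite !lfunE /= mulrA -exprS.
  have [lt_ep | le_pe] := ltnP e.+1 p.
    apply: adjoin_filtration_mem => //.
    by rewrite mulSn addnC subnDl.
  have Ee : e.+1 = p by apply/eqP; rewrite eqn_leq le_pe ltn_ord.
  rewrite Ee; apply: (subvP (sub_adjoin_filtration _)).
  apply: (subvP (filtered_le filtU _)) (filtered_mul filtU gen_powp Uu).
  by have -> : (p * w = w + e * w)%N; [rewrite -mulSn Ee | lia].
by move/subvP; apply; apply/memv_imgP; exists v; rewrite ?lfunE.
Qed.

Lemma adjoin_filtration_mulxe k e v : v \in U' k -> x ^+ e * v \in U' (k + e * w)%N.
Proof.
move=> U'v; elim: e => [|e IHe]; first by rewrite mul1r addn0.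
rewrite exprS -mulrA; have -> : (k + e.+1 * w = k + e * w + w)%N by lia.
exact: adjoin_filtration_mulx.
Qed.

Lemma adjoin_filtration_mulr k l v u : v \in U' k -> u \in U l -> v * u \in U' (k + l)%N.
Proof.
move=> U'v Uu; have: (amulr u @: U' k <= U' (k + l)%N)%VS.
  rewrite limg_sum; apply/subv_sumP => e _; apply/subvP => z.
  move=> /memv_imgP[_ /memv_imgP[u' Uu' ->] ->]; rewrite !lfunE /= -mulrA.
  apply: adjoin_filtration_mem => //.
  apply: (subvP (filtered_le filtU _)) (filtered_mul filtU Uu' Uu).
  lia.
by move/subvP; apply; apply/memv_imgP; exists v; rewrite ?lfunE.
Qed.

(** Straightening: x moves to the left past u, which becomes its conjugate by g, and by
    [filtered_conj] the error gains the weight w. *)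
Lemma commute_gen k u : u \in U k ->
  exists u1 u2, [/\ u1 \in U k, u2 \in U (k + w)%N & u * x = x * u1 + u2].
Proof.
move=> Uu; have Uc := filtered_conj filtU gLam Uu.
exists (rho g^-1%g * u * rho g), (rho g^-1%g * u * rho g - u); split=> //.
  rewrite -[X in X \in _](subrK u) memvD //.
  by apply: (subvP (filtered_le filtU _)) Uc; apply: leq_addr.
rewrite mulrBl mul1r !mulrA rhoVr mul1r mulrBr mulr1.
by rewrite addrA subrK.
Qed.

Lemma adjoin_filtration_mulrx k v : v \in U' k -> v * x \in U' (k + w)%N.
Proof.
move=> U'v; have: (amulr x @: U' k <= U' (k + w)%N)%VS.
  rewrite limg_sum; apply/subv_sumP => e _; apply/subvP => z.
  move=> /memv_imgP[_ /memv_imgP[u Uu ->] ->]; rewrite !lfunE /= -mulrA.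
  have [u1 [u2 [Uu1 Uu2 ->]]] := commute_gen Uu.
  rewrite mulrDr memvD //.
    rewrite mulrA -exprSr exprS -mulrA adjoin_filtration_mulx //.
    exact: adjoin_filtration_mem.
  apply: adjoin_filtration_mem => //.
  by apply: (subvP (filtered_le filtU _)) Uu2; lia.
by move/subvP; apply; apply/memv_imgP; exists v; rewrite ?lfunE.
Qed.

Lemma adjoin_filtration_mulrxe k e v : v \in U' k -> v * x ^+ e \in U' (k + e * w)%N.
Proof.
move=> U'v; elim: e => [|e IHe]; first by rewrite mulr1 addn0.
rewrite exprSr mulrA; have -> : (k + e.+1 * w = k + e * w + w)%N by lia.
exact: adjoin_filtration_mulrx.
Qed.

(** For a term x ^+ e * v' of v, first the power of x and then v' is absorbed into u from the
    right. *)
Lemma adjoin_filtration_mul k l u v : u \in U' k -> v \in U' l -> u * v \in U' (k + l)%N.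
Proof.
move=> U'u U'v; have: (amull u @: U' l <= U' (k + l)%N)%VS.
  rewrite limg_sum; apply/subv_sumP => e _; apply/subvP => z.
  move=> /memv_imgP[_ /memv_imgP[v' Uv' ->] ->]; rewrite !lfunE /= mulrA.
  apply: (subvP (adjoin_filtration_le _))
    (adjoin_filtration_mulr (adjoin_filtration_mulrxe e U'u) Uv').
  lia.
by move/subvP; apply; apply/memv_imgP; exists v; rewrite ?lfunE.
Qed.

Lemma gen_mem : x \in U' w.
Proof.
rewrite -[x]mulr1 -[x in X in X * _]expr1.
apply: adjoin_filtration_mem => //; rewrite mul1n subnn -rho1.
exact: filtered_rho filtU _ (group1 H).
Qed.

Lemma rho_gen_mem n : rho (g ^+ n)%g \in U' 0%N.
Proof.
have rho1U : 1 \in U' 0%N.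
  by apply: (subvP (sub_adjoin_filtration _)); rewrite -rho1 (filtered_rho filtU).
elim: n => [|n IHn]; first by rewrite rho1.
rewrite expgS rhoM -[0%N]/(0 + 0)%N adjoin_filtration_mul //.
rewrite -[rho g](subrK 1) memvD //.
exact: (subvP (adjoin_filtration_le _)) gen_mem.
Qed.

Lemma adjoin_mem h : h \in H' -> exists n, exists2 h', h' \in H & h = (g ^+ n * h')%g.
Proof.
rewrite /= norm_joinEl ?cycle_subG ?gen_norm // => /mulsgP[_ h' /cycleP[n ->] Hh' ->].
by exists n, h'.
Qed.

(** For l > l0 the layer already lies in H. Otherwise weight w suffices, and g^n h' - 1 = g^n (h' -
    1) + (g^n - 1) reduces to h' in H and to g. *)
Lemma adjoin_gen l h : h \in H' -> h \in Lam l -> rho h - 1 \in U' (p ^ l)%N.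
Proof.
move=> H'h lh; have [lt_l | le_l] := ltnP l0 l.
  have Hh : h \in H by apply: (subsetP sl0H); apply: (subsetP (layered_leq layP lt_l)).
  exact: (subvP (sub_adjoin_filtration _)) (filtered_gen filtU Hh lh).
have [n [h' Hh' ->]] := adjoin_mem H'h.
apply: (subvP (adjoin_filtration_le (_ : _ <= w)%N)); first by rewrite leq_exp2l.
have Uh' : rho h' - 1 \in U' w.
  apply: (subvP (sub_adjoin_filtration _)) (filtered_gen filtU Hh' _).
  exact: (subsetP sHl0).
rewrite rhoM; have -> : rho (g ^+ n)%g * rho h' - 1 =
    rho (g ^+ n)%g * (rho h' - 1) + (rho (g ^+ n)%g - 1).
  by rewrite mulrBr mulr1 addrA subrK.
rewrite memvD //; first by rewrite -[w]add0n adjoin_filtration_mul ?rho_gen_mem.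
rewrite rhoX subrX1 -[w]addn0 adjoin_filtration_mul ?gen_mem ?memv_suml // => i _.
by rewrite -rhoX rho_gen_mem.
Qed.

(** The defect c v - v of conjugation by y satisfies a twisted Leibniz rule, so it is enough to
    bound it on x and on U. *)
Lemma adjoin_conj l y k v : y \in Lam l -> v \in U' k ->
  rho y^-1%g * v * rho y - v \in U' (k + p ^ l)%N.
Proof.
move=> ly; pose c (z : A) := rho y^-1%g * z * rho y.
have cM a b : c (a * b) = c a * c b.
  by rewrite /c !mulrA -[X in _ = X * _ * _]mulrA rhoVr mulr1.
have good_mul j j' a b : a \in U' j -> b \in U' j' ->
    c a - a \in U' (j + p ^ l)%N -> c b - b \in U' (j' + p ^ l)%N ->
  c (a * b) - a * b \in U' (j + j' + p ^ l)%N.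
  move=> Ua Ub ca cb.
  have -> : c (a * b) - a * b = (c a - a) * c b + a * (c b - b).
    by rewrite cM mulrBl mulrBr addrA subrK.
  rewrite memvD //.
    rewrite -addnA [(j' + _)%N]addnC addnA adjoin_filtration_mul //.
    rewrite -[c b](subrK b) memvD //.
    by apply: (subvP (adjoin_filtration_le _)) cb; apply: leq_addr.
  by rewrite -addnA adjoin_filtration_mul.
have cx : c x - x \in U' (w + p ^ l)%N.
  (* Here y^-1 g y = g [g, y], and the commutator lies one layer below the deeper of g and y. *)
  have -> : c x - x = rho g * (rho [~ g, y]%g - 1).
    rewrite /c mulrBr mulr1 mulrBl rhoV opprB addrA subrK mulrBr mulr1 -!rhoM.
    by rewrite commgEl mulKVg conjgE mulgA.
  have gyl : [~ g, y]%g \in Lam (maxn l0 l).+1.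
    have [le_l | lt_l] := leqP l0 l; last exact: layeredR layP _ _ _ gLam (layP0 ly).
    by rewrite -groupV invg_comm; apply: layeredR layP _ _ _ ly genP.
  have gyH : [~ g, y]%g \in H.
    apply: (subsetP sl0H); apply: (subsetP (layered_leq layP _)) gyl.
    by rewrite ltnS leq_maxl.
  rewrite -[(w + _)%N]add0n adjoin_filtration_mul ?(rho_gen_mem 1) //.
  apply: (subvP (sub_adjoin_filtration _)).
  apply: (subvP (filtered_le filtU _)) (filtered_gen filtU gyH gyl).
  (* The weights of g and y add up to at most 2 p^max(l0, l), which p >= 2 bounds by the weight of
     the commutator. *)
  rewrite expnS; apply: (@leq_trans (2 * p ^ maxn l0 l)); last by rewrite leq_mul2r p_gt1 orbT.
  by rewrite mul2n -addnn leq_add // leq_exp2l // ?leq_maxl ?leq_maxr.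
have cxe e : c (x ^+ e) - x ^+ e \in U' (e * w + p ^ l)%N.
  elim: e => [|e IHe]; first by rewrite /c mulr1 rhoV subrr mem0v.
  rewrite exprS mulSn; apply: good_mul => //; first exact: gen_mem.
  have := adjoin_filtration_mulxe e (rho_gen_mem 0).
  by rewrite rho1 mulr1.
move=> U'v; have: ((amulr (rho y) \o amull (rho y^-1%g) - \1)%VF @: U' k <= U' (k + p ^ l))%VS.
  rewrite limg_sum; apply/subv_sumP => e _; apply/subvP => z.
  move=> /memv_imgP[_ /memv_imgP[u Uu ->] ->].
  rewrite add_lfunE comp_lfunE opp_lfunE id_lfunE !lfunE /= -/(c _).
  apply: (subvP (adjoin_filtration_le _)); last apply: (@good_mul (e * w)%N (k - e * w)%N).
  - by rewrite leq_add2r -leq_subLR.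
  - have := adjoin_filtration_mulxe e (rho_gen_mem 0).
    by rewrite rho1 mulr1.
  - exact: (subvP (sub_adjoin_filtration _)) Uu.
  - exact: cxe.
  - exact: (subvP (sub_adjoin_filtration _)) (filtered_conj filtU ly Uu).
move/subvP; apply; apply/memv_imgP; exists v => //.
by rewrite add_lfunE comp_lfunE opp_lfunE id_lfunE !lfunE.
Qed.

Lemma card_adjoin : #|H'| = (p ^ (size ws).+1)%N.
Proof.
have p_pr := pcharf_prime charAp.
have nHg : <[g]>%g \subset 'N(H)%g by rewrite cycle_subG gen_norm.
rewrite -(Lagrange (joing_subr _ H)) (filtered_card filtU) expnSr; congr (_ * _)%N.
rewrite -card_quotient; last by rewrite join_subG nHg normG.
rewrite quotientYidr // quotient_cycle ?gen_norm //; apply/eqP.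
rewrite -[#|_|]/(#[_]%g) (@nt_prime_order _ p) //.
  by rewrite -morphX ?gen_norm //= coset_id // genXp.
by apply: contra gH => /eqP /coset_idr; apply; rewrite gen_norm.
Qed.

Lemma filtered_adjoin : filtered H' (w :: ws) U'.
Proof.
have sHP := filtered_sub filtU.
split.
- by rewrite join_subG cycle_subG genP.
- move=> l; have [le_l | lt_l] := leqP l l0.
    right; apply: subset_trans (layered_leq layP le_l).
    by rewrite join_subG cycle_subG gLam sHl0.
  left; apply: subset_trans (joing_subr _ _); apply: subset_trans sl0H.
  by apply: layered_leq layP _ _ _.
- exact: card_adjoin.
- move=> v; rewrite inE => /predU1P[-> | /(filtered_ws filtU) //].
  by rewrite expn_gt0 p_gt0 -expnSr leq_exp2l.
- exact: adjoin_filtration_le.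
- move=> h /adjoin_mem[n [h' Hh' ->]]; rewrite rhoM -[0%N]/(0 + 0)%N.
  rewrite adjoin_filtration_mul ?rho_gen_mem //.
  exact: (subvP (sub_adjoin_filtration _)) (filtered_rho filtU Hh').
- move=> y cHy v U'v.
  have U0c: {in U 0%N, forall u, GRing.comm u (rho y)}.
    apply: filtered_comm filtU _ _ => h Hh; apply: cHy.
    by rewrite (subsetP (joing_subr _ _)).
  have cx e : GRing.comm (x ^+ e) (rho y).
    apply/commr_sym/commrX/commrB; last exact: commr1.
    by apply/commr_sym/cHy; rewrite (subsetP (joing_subl _ _)) ?cycle_id.
  suff /subvP/(_ v U'v)/cent1vP : (U' 0%N <= 'C[rho y])%VS by [].
  apply: adjoin_filtrationP => e u _ Uu; apply/cent1vP.
  by apply/commr_sym/commrM; apply/commr_sym => //; apply: U0c; rewrite sub0n in Uu.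
- exact: adjoin_filtration_mul.
- exact: adjoin_gen.
- exact: adjoin_conj.
- move=> k; rewrite big_cons => lt_k; apply: adjoin_filtrationP => e u lt_ep Uu.
  suff: u \in 0%VS by rewrite memv0 => /eqP ->; rewrite mulr0 mem0v.
  apply: (subvP (filtered_top filtU _)) Uu.
  have: (e * w <= w * p.-1)%N by rewrite mulnC leq_mul2l -ltnS prednK ?lt_ep ?orbT.
  by move: lt_k; lia.
(* If [C e] supplements weight k - e w in [U 0], the spaces x ^+ e C_e supplement weight k, and
   their dimensions follow the recursion of [count_lt]. *)
- move=> k.
  have /fin_all_exists2[C UC dC] (e : 'I_p) := filtered_codim filtU (k - e * w).
  exists (\sum_(e < p) (amull (x ^+ e) @: C e))%VS.
    apply: adjoin_filtrationP => e u lt_ep; rewrite sub0n => Uu.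
    have /memv_addP[u1 Uu1 [u2 Cu2 ->]] := subvP (UC (Ordinal lt_ep)) u Uu.
    rewrite mulrDr memv_add //; first exact: adjoin_filtration_mem Uu1.
    apply: (subvP (sumv_sup (Ordinal lt_ep) _ (subvv _))) => //=.
    by apply/memv_imgP; exists u2; rewrite ?lfunE.
  apply: (leq_trans (dimv_leq_sum _ _ _)); apply: leq_sum => e _.
  by apply: leq_trans (dC e); rewrite -(limg_ker_dim (amull (x ^+ e)) (C e)) leq_addl.
Qed.

End Step.

Lemma filtered_exists : exists ws U, filtered P ws U.
Proof.
suff [H [ws [U [filtU sPH]]]] : exists H ws U, filtered H ws U /\ P \subset H.
  exists ws, U; rewrite (_ : P = H) //; apply/val_inj/eqP.
  by rewrite eqEsubset sPH (filtered_sub filtU).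
(* Each extension lengthens [ws], while p ^ size ws = |H| <= |P|; so taking n = |P| forces H to
   reach P. *)
suff ext n : exists H ws U, filtered H ws U /\ (P \subset H \/ n <= size ws)%N.
  have [H [ws [U [filtU [? | le_n]]]]] := ext #|P|; first by exists H, ws, U.
  have := subset_leq_card (filtered_sub filtU); rewrite (filtered_card filtU).
  by move/(leq_trans (leq_ltn_trans le_n (ltn_expl _ p_gt1))); rewrite ltnn.
elim: n => [|n [H [ws [U [filtU sz]]]]].
  exists 1%G, [::], (fun k => if k is 0%N then 1%VS else 0%VS).
  by split; [exact: filtered1 | right].
have [sPH | nsPH] := boolP (P \subset H); first by exists H, ws, U; split=> //; left.
case: sz => [sPH | le_n]; first by rewrite sPH in nsPH.
have [l [lL sHl nlH slH]] := aligned_gap (filtered_sub filtU) (filtered_aligned filtU) nsPH.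
have /subsetPn[g gl gH] := nlH.
exists (<[g]> <*> H)%G, (p ^ l :: ws)%N, (adjoin_filtration U l g).
split; first exact: filtered_adjoin.
by right; rewrite /= ltnS.
Qed.

End Filtration.

(** Take W = U k * RQ, with RQ the span of the image of Q and 3 k just above the top weight D. As Q
    centralises P, RQ moves past [U k], so W^3 lies in U (3 k) * RQ^3 = 0. *)
Lemma cube_zero_subspace (F : fieldType) (A : falgType F) (p L : nat)
    (charAp : p \in [pchar A]) (gT : finGroupType) (rho : gT -> A)
    (rho1 : rho 1%g = 1) (rhoM : forall x y, rho (x * y)%g = rho x * rho y)
    (P Q : {group gT}) (Lam : nat -> {group gT}) (layP : layered p L P Lam)
    (cPQ : Q \subset 'C(P)%g) :
  exists ws : seq nat, [/\ #|P| = (p ^ size ws)%N,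
    {in ws, forall w, (0 < w)%N && (w * p <= p ^ L)%N} &
    exists W C : {vspace A}, [/\
      {in P & Q, forall x y, rho (x * y)%g \in (W + C)%VS},
      {in W & &, forall u v w, u * v * w = 0} &
      (\dim C <= count_lt p ws ((\sum_(w <- ws) w * p.-1) %/ 3).+1 * #|Q|)%N]].
Proof.
have [ws [U filtU]] := filtered_exists charAp rho1 rhoM layP.
exists ws; split; [exact: filtered_card filtU | exact: filtered_ws filtU |].
set D := (\sum_(w <- ws) _)%N; pose k := (D %/ 3).+1.
pose RQ := (\sum_(y in Q) <[rho y]>)%VS.
have [C UC dC] := filtered_codim filtU k.
exists (U k * RQ)%VS, (C * RQ)%VS; split.
- move=> x y Px Qy; rewrite rhoM -prodvDl; apply: memv_mul.
    exact: subvP UC _ (filtered_rho filtU Px).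
  by apply: (subvP (sumv_sup y _ (subvv _))) => //; rewrite memv_line.
- have RQc : (RQ <= 'C(U 0%N))%VS.
    apply/subv_sumP => y Qy; apply/subvP => _ /vlineP[c ->]; rewrite memvZ //.
    apply/centvP => v Uv; apply/esym; apply: (filtered_comm filtU) Uv => h Ph.
    rewrite /GRing.comm -!rhoM; congr (rho _).
    by have /centP := subsetP cPQ y Qy; move=> /(_ h Ph) ->.
  have RU j : (RQ * U j <= U j * RQ)%VS.
    apply/prodvP => r u Rr Uu; have /centvP -> := subvP RQc r Rr.
      exact: memv_mul.
    exact: subvP (filtered_le filtU (leq0n j)) u Uu.
  have UU j l : (U j * U l <= U (j + l)%N)%VS.
    by apply/prodvP => u v; apply: filtered_mul filtU _ _ _ _.
  move=> u v w Wu Wv Ww; apply/eqP; rewrite -memv0.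
  have: u * v * w \in (U k * RQ * (U k * RQ) * (U k * RQ))%VS by rewrite !memv_mul.
  apply/subvP.
  (* Absorbs one more factor W; it is applied with R = RQ, then with R = RQ * RQ. *)
  have step j (R : {vspace A}) : (R * U k <= U k * R)%VS ->
      (U j * R * (U k * RQ) <= U (j + k)%N * (R * RQ))%VS.
    move=> RUk; rewrite prodvA -[(U j * R * U k)%VS]prodvA.
    apply: (subv_trans (prodvSl _ (prodvSr _ RUk))).
    by rewrite !prodvA -!(prodvA _ R); apply: prodvSl.
  apply: (subv_trans (prodvSl _ (step k RQ (RU k)))).
  apply: (subv_trans (step (k + k)%N _ _)).
    rewrite -prodvA (subv_trans (prodvSr _ (RU k))) // !prodvA.
    exact: prodvSl.
  rewrite (subv_trans (prodvSl _ (filtered_top filtU _))) ?prod0v //.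
  by rewrite -/D /k; lia.
- apply: leq_trans (dim_prodv _ _) (leq_mul dC _).
  rewrite (leq_trans (dimv_leq_sum _ _ _)) // -sum1_card leq_sum // => y _.
  by rewrite dim_vline leq_b1.
Qed.

(** * Counting monomials of weight at most a third of the top weight *)

Section Count.

Variable R : realFieldType.

(** Markov's inequality for the generating function in t^3: a counted vector has weight at most k -
    1, whence the factor t^3. Cubing keeps exponents integral when the threshold is D / 3. *)
Lemma count_lt_weight (p : nat) (ws : seq nat) (k : nat) (t : R) : 0 < t <= 1 ->
  (count_lt p ws k)%:R * t ^+ (3 * k) <=
    t ^+ 3 * \prod_(w <- ws) \sum_(e < p) t ^+ (3 * (e * w)).
Proof.
move=> /andP[t_gt0 t_le1]; have t_ge0 := ltW t_gt0.
elim: ws k => [|w ws IHws] k /=.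
  rewrite big_nil mulr1; case: k => [|k] /=; first by rewrite mul0r exprn_ge0.
  by rewrite mul1r ler_wiXn2l //; lia.
rewrite big_cons natr_sum mulr_suml mulrCA mulr_suml.
apply: ler_sum => e _; have [le_ewk | lt_kew] := leqP (e * w) k.
  have -> : (3 * k = 3 * (e * w) + 3 * (k - e * w))%N by lia.
  by rewrite exprD [leLHS]mulrCA ler_wpM2l ?exprn_ge0.
have -> : (k - e * w = 0)%N by lia.
have -> : count_lt p ws 0 = 0%N.
  by elim: {IHws} ws => //= v ws IH; rewrite big1 // => i _; rewrite sub0n.
rewrite mul0r !mulr_ge0 ?exprn_ge0 // prodr_ge0 // => v _.
by rewrite sumr_ge0 // => i _; rewrite exprn_ge0.
Qed.

(* Pairing [e] with [p - 1 - e]: if [a, b <= 1] then [a + b <= 1 + a * b]. *)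
Lemma sum_expr3_le (p : nat) (u : R) : (0 < p)%N -> 0 <= u <= 1 ->
  \sum_(e < p) u ^+ (3 * e) <= p%:R * ((1 + u ^+ (3 * p.-1)) / 2).
Proof.
case: p => // p _ /andP[u_ge0 u_le1] /=.
rewrite mulrA ler_pdivlMr // mulr_natr mulr2n {2}(reindex_inj rev_ord_inj) /= -big_split /=.
have -> : p.+1%:R * (1 + u ^+ (3 * p)) = \sum_(e < p.+1) (1 + u ^+ (3 * p)).
  by rewrite sumr_const card_ord mulr_natl.
apply: ler_sum => e _; rewrite subSS.
have -> : u ^+ (3 * p) = u ^+ (3 * e) * u ^+ (3 * (p - e)).
  by rewrite -exprD -mulnDr subnKC // -ltnS.
have a1 : u ^+ (3 * e) <= 1 by rewrite exprn_ile1.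
have b1 : u ^+ (3 * (p - e)) <= 1 by rewrite exprn_ile1.
by nra.
Qed.

(** Chernoff's bound. After multiplication by t^D, which splits over the weights, each weight w
    contributes a factor that is compared separately with v = t^(w (p - 1)). *)
Lemma count_lt_le (p M : nat) (ws : seq nat) : (0 < p)%N -> (0 < M)%N ->
  {in ws, forall w, (0 < w * p.-1 <= M)%N} ->
  (count_lt p ws ((\sum_(w <- ws) w * p.-1) %/ 3).+1)%:R <=
    (p%:R * (1 - (32 * M%:R)^-1)) ^+ size ws :> R.
Proof.
move=> p_gt0 M_gt0 wsM; set D := (\sum_(w <- ws) _)%N.
have M0 : 0 < M%:R :> R by rewrite ltr0n.
have M1 : 1 <= M%:R :> R by rewrite ler1n.
(* By Bernoulli this t satisfies t^M >= 3/4, so every v lies in [3/4, t]. *)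
pose t : R := 1 - (4 * M%:R)^-1.
have iM0 : 0 < M%:R^-1 :> R by rewrite invr_gt0.
have iM1 : M%:R^-1 <= 1 :> R by rewrite invf_le1.
have t01 : 0 < t < 1 by rewrite /t invfM; lra.
have [t0 t1] := andP t01.
have t_ge0 := ltW t0; have t_le1 := ltW t1.
have tM : 3 / 4 <= t ^+ M.
  suff h n : 1 - n%:R * (4 * M%:R)^-1 <= t ^+ n.
    apply: le_trans (h M); rewrite invfM mulrCA divff ?mulr1 ?lt0r_neq0 //; lra.
  elim: n => [|n IHn]; first by rewrite mul0r subr0.
  rewrite exprS; apply: le_trans (ler_wpM2l t_ge0 IHn).
  rewrite -[n.+1]addn1 natrD /t; set a := (4 * _)^-1.
  have a0 : 0 <= a by rewrite /a invr_ge0 mulr_ge0 // ltW.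
  have : 0 <= n%:R * a ^+ 2 by rewrite mulr_ge0 ?ler0n ?sqr_ge0.
  by nra.
have tD : 0 < t ^+ D by rewrite exprn_gt0.
rewrite -(ler_pM2r tD).
have : (count_lt p ws (D %/ 3).+1)%:R * t ^+ (3 * (D %/ 3)) <=
    \prod_(w <- ws) \sum_(e < p) t ^+ (3 * (e * w)).
  have := @count_lt_weight p ws (D %/ 3).+1 t; rewrite t0 t_le1 => /(_ isT).
  by rewrite mulnS exprD mulrCA ler_pM2l ?exprn_gt0.
move/le_trans => h; apply: le_trans (h _ _) => {h}.
  by rewrite ler_wpM2l // ler_wiXn2l // mulnC leq_trunc_div.
rewrite {tD}/D {D}; elim: ws wsM => [|w ws IHws] wsM; first by rewrite !big_nil !mul1r expr0.
rewrite !big_cons /= exprS exprD mulrACA; apply: ler_pM.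
- by rewrite sumr_ge0 // => i _; rewrite exprn_ge0.
- by rewrite prodr_ge0 // => i _; rewrite sumr_ge0 // => j _; rewrite exprn_ge0.
- have /andP[wp0 wpM] := wsM w (mem_head _ _).
  have -> : \sum_(e < p) t ^+ (3 * (e * w)) = \sum_(e < p) (t ^+ w) ^+ (3 * e).
    by apply: eq_bigr => e _; rewrite -exprM [(w * _)%N]mulnC mulnA.
  apply: le_trans (sum_expr3_le _ _) _ => //.
    by rewrite exprn_ge0 // exprn_ile1.
  rewrite -mulrA ler_wpM2l ?ler0n // -exprM.
  have -> : (w * (3 * p.-1) = w * p.-1 * 3)%N by rewrite mulnCA mulnC.
  rewrite exprM; set v := t ^+ (w * p.-1).
  have vt : v <= t by rewrite /v -[leRHS]expr1 ler_wiXn2l.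
  have v34 : 3 / 4 <= v by apply: le_trans tM _; rewrite ler_wiXn2l.
  have -> : (32 * M%:R)^-1 = (1 - t) / 8 by rewrite /t; field; rewrite pnatr_eq0 -lt0n.
  have v1 : v < 1 by apply: le_lt_trans vt t1.
  (* The goal is (1 + v^3) / 2 <= (1 - (1 - t) / 8) v. It follows from 1 - t <= 1 - v and, as v >=
     3/4, v^2 + v - 1 >= 5/16 >= v / 4. *)
  have E : 2 * v - 1 - v ^+ 3 = (1 - v) * (v ^+ 2 + v - 1) by ring.
  have : (1 - t) * (v / 4) <= (1 - v) * (v ^+ 2 + v - 1).
    by apply: ler_pM; rewrite ?expr2; nra.
  by rewrite -E; lra.
- by apply: IHws => i wsi; apply: wsM; rewrite inE wsi orbT.
Qed.

End Count.

(** * Codimension of subspaces with vanishing cube *)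

Section DiagonalTensor.

Variable F : fieldType.

(** Restricted to a maximal set of independent columns, the row space is everything, so it contains
    the all-ones vector. *)
Lemma row_support (k m : nat) (M : 'M[F]_(k, m)) :
  exists (v : 'rV[F]_m) (f : 'I_(\rank M) -> 'I_m),
    [/\ (v <= M)%MS, injective f & forall i, v 0 (f i) = 1].
Proof.
have full_colsub r (f : 'I_r -> 'I_m) : row_free (rowsub f M^T) -> row_full (colsub f M).
  by rewrite /row_full /row_free -mxrank_tr trmx_mxsub trmxK.
rewrite -(mxrank_tr M); have /full_colsub rfull := maxrowsub_free M^T.
have /submxP[u Eu] := submx_full (const_mx 1 : 'rV_(\rank M^T)) rfull.
exists (u *m M), (maxrankfun M^T); split; [exact: submxMl | exact: maxrankfun_inj |].
move=> i; have /matrixP/(_ 0 i) := Eu; rewrite !mxE => ->.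
by apply: eq_bigr => j _; rewrite [in RHS]mxE.
Qed.

(** With v in M1 having at least \rank M1 nonzero entries and D = diag v, the hypothesis reads M2 D
    M3^T = 0; apply Sylvester's rank inequality twice. *)
Lemma diagonal_tensor_rank (m : nat) (M1 M2 M3 : 'M[F]_m) :
  (forall v1 v2 v3 : 'rV[F]_m, (v1 <= M1)%MS -> (v2 <= M2)%MS -> (v3 <= M3)%MS ->
     \sum_j v1 0 j * v2 0 j * v3 0 j = 0) ->
  (\rank M1 + \rank M2 + \rank M3 <= 2 * m)%N.
Proof.
move=> orth; have [v [f [vM f_inj vf]]] := row_support M1.
pose D := diag_mx v.
have rD : (\rank M1 <= \rank D)%N.
  have <- : \rank (mxsub f f D) = \rank M1.
    rewrite (_ : mxsub f f D = 1%:M) ?mxrank1 //.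
    by apply/matrixP => i j; rewrite !mxE vf (inj_eq f_inj).
  rewrite -[D in mxsub _ _ D]mul1mx mxsub_mul (leq_trans (mxrankM_maxr _ _)) //.
  by rewrite -[D in colsub _ D]mulmx1 -mulmx_colsub mxrankM_maxl.
have E : M2 *m (D *m M3^T) = 0.
  apply/matrixP => i j; rewrite mulmxA mul_mx_diag !mxE.
  rewrite -[RHS](orth v (row i M2) (row j M3)) ?row_sub //.
  by apply: eq_bigr => l _; rewrite !mxE [v 0 l * _]mulrC.
have := mxrank_mul_min M2 (D *m M3^T); rewrite E mxrank0.
have := mxrank_mul_min D M3^T; rewrite mxrank_tr.
move: rD; lia.
Qed.

End DiagonalTensor.

(** * Graded families of vectors modulo a subspace *)

Section GradedFamily.

Variables (F : fieldType) (V : vectType F) (W : {vspace V}) (Pos : finType).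
Variables (v : Pos -> V) (deg : Pos -> nat).

Definition tail k : {vspace V} := (\sum_(p | (k <= deg p)%N) <[v p]>)%VS.
(** Dimension of the k-th graded piece of the span modulo W, filtered by degree; the subtraction is
    exact because tails decrease. *)
Definition jump k := (\dim (W + tail k) - \dim (W + tail k.+1))%N.

Lemma mem_tail p k : (k <= deg p)%N -> v p \in tail k.
Proof.
by move=> le_kp; apply: (subvP (sumv_sup p _ (subvv _))) => //; rewrite memv_line.
Qed.

Lemma tail_le k l : (k <= l)%N -> (tail l <= tail k)%VS.
Proof.
move=> le_kl; apply/subv_sumP => p le_lp; rewrite -memvE.
by rewrite mem_tail // (leq_trans le_kl).
Qed.

Lemma sum_jump (C : {vspace V}) N : (forall p, v p \in (W + C)%VS) ->
  (\sum_(k < N) jump k <= \dim C)%N.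
Proof.
move=> vWC; have sum_le M : (\sum_(k < M) jump k + \dim (W + tail M) <= \dim (W + tail 0))%N.
  elim: M => [|M IHM]; first by rewrite big_ord0.
  rewrite big_ord_recr /= -addnA /jump subnK // dimvS ?addvS ?tail_le //.
rewrite -(leq_add2r (\dim W)); apply: leq_trans (_ : \dim (W + C) <= _)%N.
  apply: leq_trans (dimvS (_ : W + tail 0 <= W + C)%VS).
    by apply: leq_trans (sum_le N); rewrite leq_add2l dimvS ?addvSl.
  rewrite subv_add addvSl; apply/subv_sumP => p _; rewrite -memvE; exact: vWC.
by rewrite addnC (dimv_add_leqif W C).
Qed.

(** Combinations of degree-k vectors map to a graded piece of dimension [jump k]; M is the kernel of
    this map. *)
Lemma kernel_rank k m (q : 'I_m -> Pos) : (forall j, deg (q j) = k) ->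
  exists2 M : 'M[F]_m, (m <= \rank M + jump k)%N &
    forall f : 'rV[F]_m, (f <= M)%MS -> \sum_j f 0 j *: v (q j) \in (W + tail k.+1)%VS.
Proof.
move=> degq; set B' := (W + tail k.+1)%VS; set B := (W + tail k)%VS.
(* An endomorphism with kernel B' serves as the quotient map by B'. *)
pose psi : 'End(V) := (\1 - projv B')%VF.
have kerpsi : lker psi = B'.
  apply/vspaceP => x; rewrite memv_ker add_lfunE opp_lfunE id_lfunE subr_eq0.
  by apply/eqP/idP => [-> | /projv_id -> //]; apply: memv_proj.
set Z := (psi @: B)%VS.
have dimZ : \dim Z = jump k.
  rewrite /jump -/B -/B' -(limg_ker_dim psi B) kerpsi (capv_idPr _) ?addKn //.
  by rewrite addvS // tail_le.
have vZ j : psi (v (q j)) \in Z.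
  apply: memv_img; apply: (subvP (addvSr _ _)).
  by apply: mem_tail; rewrite degq.
exists (kermx (\matrix_(j < m, i < \dim Z) coord (vbasis Z) i (psi (v (q j))))).
  by rewrite mxrank_ker -dimZ addnC -leq_subLR leq_sub2l // rank_leq_col.
move=> f /sub_kermxP Ef; rewrite -/B' -kerpsi memv_ker linear_sum.
have Zs : \sum_j psi (f 0 j *: v (q j)) \in Z.
  by apply: rpred_sum => j _; rewrite linearZ; apply: memvZ; apply: vZ.
rewrite (coord_vbasis Zs) big1 // => i _; rewrite linear_sum.
have /matrixP/(_ 0 i) := Ef; rewrite !mxE => Ei.
rewrite (_ : \sum_j _ = 0) ?scale0r // -[RHS]Ei; apply: eq_bigr => j _.
by rewrite !mxE !linearZ.
Qed.

End GradedFamily.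

(** * Codimension forced by embedded matrix products *)

Section MatrixMultiplication.

Variables (F : fieldType) (A : falgType F) (lam : {scalar A}) (W C : {vspace A}).
Hypothesis W3 : {in W & &, forall u v w, u * v * w = 0}.
Variables (I : finType) (n' : nat).
Local Notation n := n'.+1.
Variables X Y Z : I -> 'I_n -> 'I_n -> A.
Hypothesis XWC : forall i c a, X i c a \in (W + C)%VS.
Hypothesis YWC : forall i a b, Y i a b \in (W + C)%VS.
Hypothesis ZWC : forall i b c, Z i b c \in (W + C)%VS.
Hypothesis lamXYZ : forall i j k a a' b b' c c',
  lam (X i c a * Y j a' b * Z k b' c') =
    [&& i == j, j == k, a == a', b == b' & c == c']%:R.

Local Notation Pos := (I * 'I_n * 'I_n)%type.
Let entry (M : I -> 'I_n -> 'I_n -> A) (p : Pos) := M p.1.1 p.1.2 p.2.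
(* The degree [n + (column - row)] adds up to [3 n] along a nonzero term of the
   trace of a product of three matrices. *)
Let deg (p : Pos) : nat := (n + p.2 - p.1.2)%N.
Local Notation tl M := (tail (entry M) deg).
Local Notation jmp M := (jump W (entry M) deg).

(** The degrees along a nonzero term add up to exactly 3 n, so none survives in these tails. *)
Lemma trace_tails k1 k2 k3 x y z : (3 * n < k1 + k2 + k3)%N ->
  x \in tl X k1 -> y \in tl Y k2 -> z \in tl Z k3 -> lam (x * y * z) = 0.
Proof.
move=> k123 Xx Yy Zz.
have [xs xsP ->] := memv_sumP Xx; have [ys ysP ->] := memv_sumP Yy.
have [zs zsP ->] := memv_sumP Zz.
rewrite !mulr_suml linear_sum big1 // => p p1; have /vlineP[c1 ->] := xsP p p1.
rewrite mulr_sumr linear_sum big1 // => r r1; have /vlineP[c3 ->] := zsP r r1.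
rewrite mulr_sumr mulr_suml linear_sum big1 // => q q1; have /vlineP[c2 ->] := ysP q q1.
rewrite -!(scalerAl, scalerAr) !linearZ /= /entry lamXYZ.
case: eqP => [_|]; last by rewrite !mulr0.
case: eqP => [_|]; last by rewrite !mulr0.
case: eqP => [E1|]; last by rewrite !mulr0.
case: eqP => [E2|]; last by rewrite !mulr0.
case: eqP => [E3|]; last by rewrite !mulr0.
exfalso; move: p1 q1 r1; rewrite /deg E1 E2 E3.
move: (ltn_ord q.1.2) (ltn_ord r.1.2) (ltn_ord r.2).
by move: (nat_of_ord q.1.2) (nat_of_ord r.1.2) (nat_of_ord r.2) => a b c; clear -k123; lia.
Qed.

(** Replacing each factor by its component in W costs a term of total degree above 3 n, where the
    trace vanishes; what remains is a product of three elements of W. *)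
Lemma trace_mod_tails k1 k2 k3 x y z : (k1 + k2 + k3 = 3 * n)%N ->
  x \in tl X k1 -> y \in tl Y k2 -> z \in tl Z k3 ->
  x \in (W + tl X k1.+1)%VS -> y \in (W + tl Y k2.+1)%VS ->
  z \in (W + tl Z k3.+1)%VS -> lam (x * y * z) = 0.
Proof.
move=> k123 Tx Ty Tz /memv_addP[w1 W1 [t1 T1 E1]] /memv_addP[w2 W2 [t2 T2 E2]].
move=> /memv_addP[w3 Ww3 [t3 T3 E3]].
have Tw1 : w1 \in tl X k1.
  have -> : w1 = x - t1 by rewrite E1 addrK.
  by apply: memvB => //; apply: (subvP (tail_le _ _ (leqnSn _))).
have Tw2 : w2 \in tl Y k2.
  have -> : w2 = y - t2 by rewrite E2 addrK.
  by apply: memvB => //; apply: (subvP (tail_le _ _ (leqnSn _))).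
have e1 : lam (t1 * y * z) = 0 by apply: trace_tails T1 Ty Tz; rewrite -k123; lia.
have e2 : lam (w1 * t2 * z) = 0 by apply: trace_tails Tw1 T2 Tz; rewrite -k123; lia.
have e3 : lam (w1 * w2 * t3) = 0 by apply: trace_tails Tw1 Tw2 T3; rewrite -k123; lia.
have -> : lam (x * y * z) = lam (w1 * y * z).
  by rewrite E1 !mulrDl linearD /= e1 addr0.
have -> : lam (w1 * y * z) = lam (w1 * w2 * z).
  by rewrite E2 mulrDr mulrDl linearD /= e2 addr0.
by rewrite E3 mulrDr linearD /= e3 addr0 W3 // linear0.
Qed.

(** On the diagonals r -> r + d -> r + d + e -> r, for r < q in every block, the trace of a product
    is a sum of pointwise products. The kernels of [kernel_rank] then meet [diagonal_tensor_rank].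
    The bound on q gives r + d + e <= 3 (q - 1) < n. *)
Lemma diagonal_jump d e q : (3 * q <= n + 2)%N -> (d < q)%N -> (e < q)%N ->
  (#|I| * q <= jmp X (n + d) + jmp Y (n + e) + jmp Z (n - d - e))%N.
Proof.
move=> qn dq eq; pose J := (I * 'I_q)%type; set m := #|{: J}|.
pose row0 (j : 'I_m) : nat := (enum_val j).2.
pose qX (j : 'I_m) : Pos := ((enum_val j).1, inord (row0 j), inord (row0 j + d)).
pose qY (j : 'I_m) : Pos := ((enum_val j).1, inord (row0 j + d), inord (row0 j + d + e)).
pose qZ (j : 'I_m) : Pos := ((enum_val j).1, inord (row0 j + d + e), inord (row0 j)).
have row0P j : (row0 j < q)%N by apply: ltn_ord.
have [lt0 [lt1 lt2]] : (forall j, row0 j < n)%N /\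
    (forall j, row0 j + d < n)%N /\ (forall j, row0 j + d + e < n)%N.
  by split; [|split]=> j; move: (row0P j); move: (row0 j) => r; clear -dq eq qn; lia.
have dX j : deg (qX j) = (n + d)%N.
  by rewrite /deg /= !inordK ?lt0 ?lt1 // addnCA addKn.
have dY j : deg (qY j) = (n + e)%N.
  by rewrite /deg /= !inordK ?lt1 ?lt2 // addnCA addKn.
have dZ j : deg (qZ j) = (n - d - e)%N.
  by rewrite /deg /= !inordK ?lt0 ?lt2 // -addnA -subnDA [(n + _)%N]addnC subnDl.
have [M1 r1 M1P] := kernel_rank W (entry X) dX.
have [M2 r2 M2P] := kernel_rank W (entry Y) dY.
have [M3 r3 M3P] := kernel_rank W (entry Z) dZ.
have -> : (#|I| * q = m)%N by rewrite /m card_prod card_ord.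
suff: (\rank M1 + \rank M2 + \rank M3 <= 2 * m)%N by move: r1 r2 r3; lia.
apply: diagonal_tensor_rank => f g h fM gM hM.
have fWX := M1P f fM; have gWY := M2P g gM; have hWZ := M3P h hM.
set fX := \sum_j f 0 j *: _ in fWX.
set gY := \sum_j g 0 j *: _ in gWY.
set hZ := \sum_j h 0 j *: _ in hWZ.
have TX : fX \in tl X (n + d).
  by apply: rpred_sum => j _; apply: memvZ; apply: mem_tail; rewrite dX.
have TY : gY \in tl Y (n + e).
  by apply: rpred_sum => j _; apply: memvZ; apply: mem_tail; rewrite dY.
have TZ : hZ \in tl Z (n - d - e).
  by apply: rpred_sum => j _; apply: memvZ; apply: mem_tail; rewrite dZ.
have: lam (fX * gY * hZ) = 0.
  by apply: trace_mod_tails TX TY TZ fWX gWY hWZ; clear -dq eq qn; lia.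
move=> E0; rewrite -[RHS]E0 /fX /gY /hZ !mulr_suml linear_sum; apply: eq_bigr => j1 _.
rewrite mulr_sumr linear_sum (bigD1 j1) //=.
(* Block and row determine a position on a diagonal, so the triple sum collapses to its diagonal
   terms. *)
rewrite [X in _ + X]big1 ?addr0 => [|j3 j31].
  rewrite mulr_sumr mulr_suml linear_sum (bigD1 j1) //=.
  rewrite [X in _ + X]big1 ?addr0 => [|j2 j21].
    rewrite -!(scalerAl, scalerAr) !linearZ /= /entry /= lamXYZ !eqxx /=.
    by rewrite ?mulr1; ring.
  rewrite -!(scalerAl, scalerAr) !linearZ /= /entry /= lamXYZ.
  case: eqP => [E|]; last by rewrite !mulr0.
  case: eqP => [_|]; last by rewrite !mulr0.
  case: eqP => [/(congr1 val)|]; last by rewrite !mulr0.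
  rewrite /= !inordK ?lt1 //.
  move=> /addIn E'; case/eqP: j21; apply: enum_val_inj.
  by apply/eqP; rewrite -pair_eqE /= E eqxx; apply/eqP/val_inj.
rewrite mulr_sumr mulr_suml linear_sum big1 // => j2 _.
rewrite -!(scalerAl, scalerAr) !linearZ /= /entry /= lamXYZ.
case: eqP => [E|]; last by rewrite !mulr0.
case: eqP => [E2|]; last by rewrite !mulr0.
case: (_ == _); last by rewrite !mulr0.
case: (_ == _); last by rewrite !mulr0.
case: eqP => [/(congr1 val)|]; last by rewrite !mulr0.
rewrite /= !inordK ?lt0 //.
move=> E'; case/eqP: j31; apply: enum_val_inj.
by apply/eqP; rewrite -pair_eqE /= E E2 eqxx; apply/eqP/val_inj.
Qed.

(** Sum [diagonal_jump] over all d, e < q. With the other offset fixed, each family of jumps runs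
    over distinct degrees, so its sum is at most \dim C. *)
Lemma matrix_codim_ge q : (3 * q <= n + 2)%N -> (#|I| * q ^ 2 <= 3 * \dim C)%N.
Proof.
move=> qn; have [-> | q_gt0] := posnP q; first by rewrite exp0n ?muln0.
rewrite -(leq_pmul2r q_gt0).
have winX (h : nat -> nat) N : (\sum_(d < q) h (N + d) <= \sum_(k < N + q) h k)%N.
  by rewrite big_split_ord /= leq_addl.
have winZ (h : nat -> nat) N : (q <= N.+1)%N ->
    (\sum_(e < q) h (N - e)%N <= \sum_(k < N.+1) h k)%N.
  move=> le_qN; rewrite [leqRHS](reindex_inj rev_ord_inj) /=.
  rewrite -(subnKC le_qN) big_split_ord /= subnKC //.
  under eq_bigr => i _ do rewrite -subSS.
  by rewrite leq_addr.
have SX N : (\sum_(k < N) jmp X k <= \dim C)%N by apply: sum_jump => p; apply: XWC.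
have SY N : (\sum_(k < N) jmp Y k <= \dim C)%N by apply: sum_jump => p; apply: YWC.
have SZ N : (\sum_(k < N) jmp Z k <= \dim C)%N by apply: sum_jump => p; apply: ZWC.
have -> : (#|I| * q ^ 2 * q = \sum_(d < q) \sum_(e < q) #|I| * q)%N.
  by rewrite !sum_nat_const !card_ord; lia.
apply: (@leq_trans (\sum_(d < q) \sum_(e < q)
  (jmp X (n + d) + jmp Y (n + e) + jmp Z (n - d - e)))).
  by apply: leq_sum => d _; apply: leq_sum => e _; apply: diagonal_jump.
have -> : (3 * \dim C * q = q * \dim C + \sum_(d < q) (\dim C + \dim C))%N.
  by rewrite sum_nat_const card_ord; lia.
under eq_bigr => d _ do rewrite !big_split /= sum_nat_const card_ord -addnA.
rewrite big_split /= -big_distrr /= leq_add //.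
  by rewrite leq_mul2l (leq_trans (winX _ _)) ?orbT.
apply: leq_sum => d _; rewrite leq_add //; first exact: leq_trans (winX _ _) _.
by apply: leq_trans (winZ _ _ _) _ => //; have := ltn_ord d; lia.
Qed.

End MatrixMultiplication.

(** * Simultaneous triple products *)

(** The regular representation inside the full matrix algebra, with a diagonal entry as [lam]. The
    size is written as a successor to obtain the algebra structure. *)
Lemma regular_algebra (F : fieldType) (gT : finGroupType) :
  exists (A : falgType F) (rho : gT -> A) (lam : {scalar A}),
    [/\ rho 1%g = 1, forall x y, rho (x * y)%g = rho x * rho y &
        forall x, lam (rho x) = (x == 1%g)%:R].
Proof.
have cardN : #|gT|.-1.+1 = #|gT| by rewrite prednK // -cardsT cardG_gt0.
pose A : falgType F := 'M[F]_(#|gT|.-1.+1).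
pose f (i : 'I_(#|gT|.-1.+1)) : gT := enum_val (cast_ord cardN i).
pose f' (x : gT) : 'I_(#|gT|.-1.+1) := cast_ord (esym cardN) (enum_rank x).
have fK : cancel f f' by move=> i; rewrite /f /f' enum_valK cast_ordK.
have f'K : cancel f' f by move=> x; rewrite /f /f' cast_ordKV enum_rankK.
pose rho (x : gT) : A := \matrix_(i, j) (f i * x == f j)%g%:R.
pose l (M : A) : F := M (f' 1%g) (f' 1%g).
have l_lin : scalar l by move=> a M N; rewrite /l !mxE.
pose lam : {scalar A} := HB.pack l (GRing.isLinear.Build _ _ _ _ l l_lin).
exists A, rho, lam; split=> [|x y|x].
- by apply/matrixP => i j; rewrite !mxE mulg1 (inj_eq (can_inj fK)).
- apply/matrixP => i j; rewrite !mxE (bigD1 (f' (f i * x)%g)) //= !mxE f'K eqxx mul1r.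
  rewrite big1 ?addr0 ?mulgA // => k k'; rewrite !mxE.
  case: eqP => [E | _]; last by rewrite mul0r.
  by rewrite E fK eqxx in k'.
- by rewrite /= /l mxE f'K mul1g.
Qed.

Section STPPOperations.

Local Open Scope group_scope.

(** Being trivial is invariant under cyclic rotation of a product, here of the three quotients. *)
Lemma STPP_rot gT (G : {group gT}) (I : finType) (S T U : I -> {set gT}) :
  STPP G S T U -> STPP G T U S.
Proof.
have rot (a b c : gT) : b * c * a = 1 -> a * b * c = 1.
  by move=> E; apply: (mulgI a^-1); rewrite !mulgA mulVg mul1g mulg1 -[LHS](mulgK a) E mul1g.
case=> sub tri sim; split=> [i | i s s' t t' u u' Ss Ss' Tt Tt' Uu Uu' E |
    i j k s s' t t' u u' Ss Ss' Tt Tt' Uu Uu' E].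
- by have [? ? ?] := sub i.
- have /rot E' : (s^-1 * s') * (t^-1 * t') * (u^-1 * u') = 1 by rewrite !mulgA.
  by have [] := tri i u u' s s' t t' Uu Uu' Ss Ss' Tt Tt'; rewrite ?[LHS]mulgA -?[RHS]E' ?mulgA.
- have /rot E' : (s^-1 * s') * (t^-1 * t') * (u^-1 * u') = 1 by rewrite !mulgA.
  have [] := sim k i j u u' s s' t t' Uu Uu' Ss Ss' Tt Tt'; rewrite -?[RHS]E' ?mulgA //.
  by move=> -> ->.
Qed.

Lemma STPP_comp gT (G : {group gT}) (I J : finType) (f : J -> I) (S T U : I -> {set gT}) :
  injective f -> STPP G S T U -> STPP G (S \o f) (T \o f) (U \o f).
Proof.
move=> f_inj [sub tri sim]; split=> [i | i | i j k s s' t t' u u' Ss Ss' Tt Tt' Uu Uu' E] /=.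
- exact: sub.
- exact: tri.
- by have [/f_inj -> /f_inj ->] := sim _ _ _ s s' t t' u u' Ss Ss' Tt Tt' Uu Uu' E.
Qed.

Lemma STPP_prod gT hT (G : {group gT}) (H : {group hT}) (I J : finType)
    (S T U : I -> {set gT}) (S' T' U' : J -> {set hT}) :
  STPP G S T U -> STPP H S' T' U' ->
  STPP (setX_group G H) (fun ij : I * J => setX (S ij.1) (S' ij.2))
    (fun ij => setX (T ij.1) (T' ij.2)) (fun ij => setX (U ij.1) (U' ij.2)).
Proof.
move=> [sub tri sim] [sub' tri' sim']; split.
- by move=> i; have [? ? ?] := sub i.1; have [? ? ?] := sub' i.2; split; apply: setXS.
- move=> i [s1 s2] [s1' s2'] [t1 t2] [t1' t2'] [u1 u2] [u1' u2'].
  move=> /setXP[/= ? ?] /setXP[/= ? ?] /setXP[/= ? ?] /setXP[/= ? ?] /setXP[/= ? ?] /setXP[/= ? ?].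
  case=> E1 E2; have [//|//|//|//|//|//| |-> -> ->] := tri i.1 s1 s1' t1 t1' u1 u1'.
    by [].
  by have [//|//|//|//|//|//|//|-> -> ->] := tri' i.2 s2 s2' t2 t2' u2 u2'.
- move=> [i1 i2] [j1 j2] [k1 k2] [s1 s2] [s1' s2'] [t1 t2] [t1' t2'] [u1 u2] [u1' u2'].
  move=> /setXP[/= ? ?] /setXP[/= ? ?] /setXP[/= ? ?] /setXP[/= ? ?] /setXP[/= ? ?] /setXP[/= ? ?].
  case=> E1 E2; have [//|//|//|//|//|//|//|-> ->] := sim i1 j1 k1 s1 s1' t1 t1' u1 u1'.
  by have [//|//|//|//|//|//|//|-> ->] := sim' i2 j2 k2 s2 s2' t2 t2' u2 u2'.
Qed.

End STPPOperations.

(** * Groups to which the estimate applies *)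

Section Hosts.

Local Open Scope group_scope.

(** G = P x Q with P layered and not too small. The parameters stay fixed under direct products,
    which allows passing to powers of G. *)
Record host (p L m : nat) (gT : finGroupType) (G : {group gT}) : Prop := Host {
  host_exists : exists (P Q : {group gT}) Lam, [/\ layered p L P Lam, Q \subset 'C(P),
    G \subset P * Q, (#|P| * #|Q| <= #|G|)%N & (#|G| <= #|P| ^ m)%N] }.

Lemma host_prod p L m gT hT (G : {group gT}) (H : {group hT}) :
  host p L m G -> host p L m H -> host p L m (setX_group G H).
Proof.
move=> [[P [Q [Lam [[L0 LL LS LR LX] cPQ sG cG leG]]]]].
move=> [[P' [Q' [Lam' [[L0' LL' LS' LR' LX'] cPQ' sG' cG' leG']]]]].
split; exists (setX_group P P'), (setX_group Q Q'), (fun l => setX_group (Lam l) (Lam' l)).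
split.
- split=> [||l|l [x x'] [y y']|l [x x']].
  + by rewrite L0 L0'.
  + apply/subsetP => -[x x'] /setXP[Lx Lx'].
    have /set1P -> := subsetP LL _ Lx; have /set1P -> := subsetP LL' _ Lx'.
    exact: set11.
  + exact: setXS.
  + move=> /setXP[Lx Lx'] /setXP[Py Py'].
    by apply/setXP; split; [apply: LR | apply: LR'].
  + move=> /setXP[Lx Lx'].
    have -> n : (x, x') ^+ n = (x ^+ n, x' ^+ n).
      by elim: n => // n IHn; rewrite !expgS IHn.
    by apply/setXP; split; [apply: LX | apply: LX'].
- apply/subsetP => -[x x'] /setXP[Qx Qx']; apply/centP => -[y y'] /setXP[Py Py'].
  rewrite /commute; congr (_, _).
    by have /centP := subsetP cPQ x Qx; apply.
  by have /centP := subsetP cPQ' x' Qx'; apply.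
- apply/subsetP => -[x x'] /setXP[/(subsetP sG)/mulsgP[a b Pa Qb ->]].
  move=> /(subsetP sG')/mulsgP[a' b' Pa' Qb' ->].
  by apply/mulsgP; exists (a, a') (b, b') => //; apply/setXP.
- by rewrite !cardsX mulnACA leq_mul.
- by rewrite !cardsX expnMn leq_mul.
Qed.

End Hosts.

(** Compares the codimension bound of [cube_zero_subspace] over F_p with that of [matrix_codim_ge];
    multiplying by |P| turns |Q| into |G|. *)
Lemma host_square_le (p L m : nat) (gT : finGroupType) (G : {group gT}) :
  prime p -> host p L m G ->
  exists ws : seq nat, [/\ (#|G| <= p ^ (size ws * m))%N,
    {in ws, forall w, (0 < w * p.-1 <= p ^ L)%N} &
    forall (I : finType) (S T U : I -> {set gT}) (n q : nat), STPP G S T U ->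
      (forall i, [/\ n <= #|S i|, n <= #|T i| & n <= #|U i|]%N) -> (3 * q <= n + 2)%N ->
      (#|I| * q ^ 2 * p ^ size ws <=
        3 * count_lt p ws ((\sum_(w <- ws) w * p.-1) %/ 3).+1 * #|G|)%N].
Proof.
move=> p_pr [[P [Q [Lam [layP cPQ sG cG leG]]]]].
have [A [rho [lam [rho1 rhoM lamrho]]]] := regular_algebra 'F_p gT.
have charAp : p \in [pchar A] by rewrite pchar_lalg pchar_Fp.
have [ws [cardP wsP [W [C [PQWC W3 dC]]]]] := cube_zero_subspace charAp rho1 rhoM layP cPQ.
exists ws; split; first by rewrite expnM -cardP.
  move=> w /wsP /andP[w0 wp]; rewrite muln_gt0 w0 -subn1 subn_gt0 prime_gt1 //=.
  by rewrite (leq_trans _ wp) // leq_mul2l leq_subr orbT.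
have GWC g : g \in G -> rho g \in (W + C)%VS.
  by move=> /(subsetP sG)/mulsgP[x y Px Qy ->]; apply: PQWC.
move=> I S T U n q [sub tri sim] card_ge q_le.
have [n0 | n_gt0] := posnP n.
  have -> : q = 0%N by move: q_le; rewrite n0; lia.
  by rewrite exp0n // muln0 mul0n.
case: n n_gt0 card_ge q_le => // n _ card_ge q_le.
pose el (B : I -> {set gT}) i (a : 'I_n.+1) := nth 1%g (enum (B i)) a.
have elP (B : I -> {set gT}) i a : (n.+1 <= #|B i|)%N -> el B i a \in B i.
  by move=> leB; rewrite -mem_enum mem_nth // -cardE (leq_trans (ltn_ord a)).
have el_inj (B : I -> {set gT}) i a b : (n.+1 <= #|B i|)%N -> el B i a = el B i b -> a = b.
  move=> leB /eqP; rewrite nth_uniq ?enum_uniq -?cardE ?(leq_trans (ltn_ord _)) //.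
  by move/eqP/val_inj.
have memS i a : el S i a \in S i by apply: elP; have [] := card_ge i.
have memT i a : el T i a \in T i by apply: elP; have [] := card_ge i.
have memU i a : el U i a \in U i by apply: elP; have [] := card_ge i.
have GS i a : el S i a \in G by have [/subsetP-> //] := sub i.
have GT i a : el T i a \in G by have [_ /subsetP-> //] := sub i.
have GU i a : el U i a \in G by have [_ _ /subsetP-> //] := sub i.
(* The quotients are arranged so that matching inner indices cancel; a product equal to 1 is
   conjugate to the relation of the triple product property. *)
pose X i c a := rho (el U i c * (el S i a)^-1)%g.
pose Y i a b := rho (el S i a * (el T i b)^-1)%g.
pose Z i b c := rho (el T i b * (el U i c)^-1)%g.
have: (#|I| * q ^ 2 <= 3 * \dim C)%N.
  apply: (@matrix_codim_ge _ A lam W C W3 I n X Y Z); last exact: q_le.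
  - by move=> i c a; rewrite GWC // groupM ?groupV.
  - by move=> i c a; rewrite GWC // groupM ?groupV.
  - by move=> i c a; rewrite GWC // groupM ?groupV.
  move=> i j k a a' b b' c c'; rewrite -!rhoM lamrho; congr (_ %:R).
  congr nat_of_bool; apply/eqP/and5P => [E | [/eqP<- /eqP<- /eqP<- /eqP<- /eqP<-]]; last first.
    by rewrite !mulgA mulgKV mulgKV mulgV.
  have E' : ((el S i a)^-1 * el S j a' * (el T j b)^-1 * el T k b' *
      (el U k c')^-1 * el U i c = 1)%g.
    by apply: (mulgI (el U i c)); rewrite mulg1 -[RHS]mul1g -E !mulgA.
  have [? ?] := sim i j k _ _ _ _ _ _ (memS i a) (memS j a') (memT j b) (memT k b')
    (memU k c') (memU i c) E'.
  subst j k; have [Ea Eb Ec] := tri i _ _ _ _ _ _ (memS i a) (memS i a') (memT i b) (memT i b')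
    (memU i c') (memU i c) E'.
  have [leS leT leU] := card_ge i.
  rewrite (el_inj _ _ _ _ leS Ea) (el_inj _ _ _ _ leT Eb) (el_inj _ _ _ _ leU Ec).
  by split; apply/eqP.
move=> le_dC; rewrite -cardP.
apply: leq_trans (leq_mul le_dC (leqnn _)) _.
rewrite -mulnA -[leqRHS]mulnA leq_mul2l /=.
apply: leq_trans (leq_mul dC (leqnn _)) _.
by rewrite -mulnA leq_mul2l [(#|Q| * _)%N]mulnC cG orbT.
Qed.

(** * Nilpotent groups *)

Section NilpotentHost.

Local Open Scope group_scope.

(** The lower exponent-p-central series when P is a p-group: ['Mho^1] is then generated by the p-th
    powers. *)
Fixpoint lower_pseries (gT : finGroupType) (P : {group gT}) l : {group gT} :=
  if l is l'.+1 then
    ([~: lower_pseries P l', P] <*> 'Mho^1(lower_pseries P l'))%G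
  else P.

Variables (gT : finGroupType) (p : nat) (P : {group gT}).
Hypothesis pP : p.-group P.
Local Notation Lam := (lower_pseries P).

Lemma lower_pseries_normal l : normal (Lam l) P.
Proof.
elim: l => [|l IHl] /=; first exact: normal_refl.
have nP := normal_norm IHl; have sP := normal_sub IHl.
rewrite /normal join_subG commg_subr ?(subset_trans sP) ?normG //=.
rewrite (subset_trans (Mho_sub _ _) sP) normsY ?normsR ?normG //.
exact: normal_norm (gFnormal_trans _ IHl).
Qed.

(** Crossing one factor A of the lower central series takes at most e steps: after k steps the image
    lies in ['Mho^k(A)], which is trivial for k = e. *)
Lemma lower_pseries_layered e c : (exponent P %| p ^ e)%N -> 'L_c.+1(P) = 1 ->
  layered p (c * e) P Lam.
Proof.
move=> expP Lc.
have pLam l : p.-group (Lam l) by apply: pgroupS pP; apply: normal_sub (lower_pseries_normal l).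
have LamL j : Lam (j * e) \subset 'L_j.+1(P).
  elim: j => [|j IHj]; first by rewrite lcn1.
  set R := 'L_j.+2(P); set A := 'L_j.+1(P) / R.
  have nR : P \subset 'N(R) by rewrite normal_norm ?lcn_normal.
  have abA : abelian A.
    apply: sub_der1_abelian; exact: commgS (lcn_sub _ _).
  have pA : p.-group A by rewrite quotient_pgroup // (pgroupS (lcn_sub _ _)).
  have LamA k : Lam (j * e + k) / R \subset 'Mho^k(A).
    elim: k => [|k IHk]; first by rewrite addn0 Mho0 quotientS.
    have sLP := normal_sub (lower_pseries_normal (j * e + k)).
    have LamLj : Lam (j * e + k) \subset 'L_j.+1(P).
      have := subset_trans IHk (Mho_sub _ _).
      rewrite quotientSGK //; first exact: subset_trans sLP nR.
      exact: lcn_subS.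
    rewrite addnS /= quotientY; last 2 first.
    - by rewrite (subset_trans _ nR) // commg_subr (subset_trans sLP) ?normG.
    - by rewrite (subset_trans (Mho_sub _ _)) // (subset_trans sLP).
    rewrite join_subG; apply/andP; split.
      (* The commutator part already lies in R, so only p-th powers remain. *)
      rewrite quotientS1 ?sub1G //; exact: commSg LamLj.
    rewrite -[('Mho^1(_) / _)%g]/(coset R @* 'Mho^1(_)) morphim_Mho ?(subset_trans sLP) //.
    apply: subset_trans (MhoS 1 IHk) _.
    have pM : p.-group 'Mho^k(A) by apply: pgroupS (Mho_sub _ _) pA.
    rewrite (MhoE 1 pM) gen_subG; apply/subsetP => _ /imsetP[x Mx ->].
    have /imsetP[y Ay ->] : x \in [set z ^+ (p ^ k) | z in A].
      by have <- := MhoEabelian k pA abA.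
    by rewrite -expgM -expnD addn1 Mho_p_elt // (mem_p_elt pA).
  have := LamA e; rewrite mulSn addnC.
  have -> : 'Mho^e(A) = 1.
    have -> := MhoE e pA; apply/trivgP; rewrite gen_subG; apply/subsetP => _ /imsetP[x Ax ->].
    rewrite inE; apply/eqP; apply: (exponentP _) Ax.
    apply: dvdn_trans (exponent_quotient _ _) _.
    by apply: dvdn_trans (exponentS (lcn_sub _ _)) expP.
  rewrite quotient_sub1 // (subset_trans _ nR) //.
  exact: normal_sub (lower_pseries_normal _).
split=> [||l|l x y Lx Py|l x Lx] //=.
- by rewrite -Lc; apply: LamL.
- rewrite join_subG Mho_sub andbT commg_subl.
  exact: normal_norm (lower_pseries_normal l).
- by apply: (subsetP (joing_subl _ _)); apply: mem_commg.
- apply: (subsetP (joing_subr _ _)); rewrite -[p]expn1.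
  by apply: Mho_p_elt => //; apply: mem_p_elt (pLam l) Lx.
Qed.

End NilpotentHost.

(** n is a product of at most m prime-power parts, each bounded by the largest. *)
Lemma card_le_max_part (n m : nat) : (1 < n)%N -> {in primes n, forall p, p <= m}%N ->
  exists2 p, p \in primes n & (n <= n`_p ^ m)%N.
Proof.
move=> n_gt1 le_m; have n_gt0 := ltnW n_gt1.
have pn : pdiv n \in primes n by rewrite mem_primes pdiv_prime // n_gt0 pdiv_dvd.
have lt_m q : q \in primes n -> (q < m.+1)%N by move/le_m; rewrite ltnS.
pose i0 := Ordinal (lt_m _ pn).
have [p pP maxp] :=
  @arg_maxnP _ i0 (fun i : 'I_m.+1 => val i \in primes n) (fun i => n`_(val i))%N pn.
exists (val p) => //.
have {1}-> : (n = \prod_(q <- primes n) n`_q)%N.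
  rewrite {1}(prod_prime_decomp n_gt0) prime_decompE big_map.
  by apply: eq_bigr => q _; rewrite p_part.
apply: (@leq_trans (\prod_(q <- primes n) n`_p)%N).
  rewrite big_seq [leqRHS]big_seq; apply: leq_prod => q qn.
  exact: (maxp (Ordinal (lt_m _ qn))).
rewrite big_const_seq count_predT iter_muln_1 leq_pexp2l ?part_gt0 //.
rewrite -[m in (_ <= m)%N](size_iota 1) uniq_leq_size ?primes_uniq // => q qn.
by rewrite mem_iota add1n ltnS le_m // andbT; move: qn; rewrite mem_primes => /andP[/prime_gt0].
Qed.

(** Primes dividing |G| divide the exponent, hence are at most m. P is the largest Sylow subgroup
    and Q its p'-complement; an exponent p^e <= m gives e <= m. *)
Lemma nilpotent_host (gT : finGroupType) (G : {group gT}) (m c : nat) :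
  nilpotent G -> (exponent G <= m)%N -> (nil_class G <= c)%N ->
  exists p, [/\ prime p, (p <= m.+1)%N & host p (c * m) m G].
Proof.
move=> nilG expG classG.
have m_gt0 : (0 < m)%N by apply: leq_trans expG; apply: exponent_gt0.
suff [p [p_pr le_pm cardG]] :
    exists p, [/\ prime p, (p <= m.+1)%N & (#|G| <= #|pcore p G| ^ m)%N].
  exists p; split=> //.
  split; exists (pcore_group p G), (pcore_group p^' G), (lower_pseries (pcore_group p G)).
  have defG := nilpotent_pcoreC p nilG; have [_ mulPQ cPQ _] := dprodP defG.
  split=> //; last 2 first.
  - by rewrite mulPQ.
  - by rewrite (dprod_card defG).
  have pP : (p.-group (pcore p G))%g by apply: pcore_pgroup.
  apply: lower_pseries_layered => //.
    have pexp : p.-nat (exponent (pcore p G)) by rewrite /= pnat_exponent.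
    have [e Ee] := p_natP pexp; rewrite Ee dvdn_exp2l //.
    have : (exponent (pcore p G) <= m)%N.
      by apply: leq_trans expG; rewrite dvdn_leq ?exponent_gt0 ?exponentS ?pcore_sub.
    rewrite Ee; apply: leq_trans; exact: ltnW (ltn_expl _ (prime_gt1 p_pr)).
  apply/trivgP; rewrite -[1%g](lcn_nil_classP _ nilG classG).
  by apply: lcnS; apply: pcore_sub.
have [G1 | ntG] := eqVneq #|G| 1%N.
  (* The trivial group has no prime divisor; 2 is used, and m may be 1, hence the bound m + 1. *)
  by exists 2; split; rewrite ?ltnS // G1 expn_gt0 cardG_gt0.
have cardG_gt1 : (1 < #|G|)%N by rewrite ltn_neqAle eq_sym ntG cardG_gt0.
have primes_le : {in primes #|G|, forall p, p <= m}%N.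
  move=> p pG; apply: leq_trans expG; rewrite dvdn_leq ?exponent_gt0 //.
  have : p \in \pi(G) by [].
  by rewrite -pi_of_exponent mem_primes => /and3P[].
have [p pG leG] := card_le_max_part cardG_gt1 primes_le.
exists p; split; first by move: pG; rewrite mem_primes => /andP[].
  by rewrite ltnW // ltnS primes_le.
by rewrite (card_Hall (nilpotent_pcore_Hall p nilG)).
Qed.

(** * Asymptotics *)

Section RealEstimates.

Variable R : realType.
Implicit Types (gT : finGroupType) (y D eps : R).

(** For y > 1 the left side is doubly exponential in k, while the right side grows only like 8^k. *)
Lemma le1_of_pow2_growth y D : 0 <= y ->
  (forall k, y ^+ (2 ^ k) <= D * (2 ^ k)%:R ^+ 3) -> y <= 1.
Proof.
move=> y_ge0 yD; rewrite leNgt; apply/negP => y_gt1.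
have bern n : 1 + n%:R * (y - 1) <= y ^+ n.
  elim: n => [|n IHn]; first by rewrite mul0r addr0 expr0.
  rewrite exprS; apply: le_trans (ler_wpM2l y_ge0 IHn).
  have : 0 <= n%:R * (y - 1) ^+ 2 by rewrite mulr_ge0 ?sqr_ge0.
  by rewrite -[n.+1]addn1 natrD; nra.
have exnat (x : R) : exists k, x <= k%:R.
  by exists (Num.trunc x).+1; apply/ltW/truncnS_gt.
(* 16 = 2 * 8: a factor 8 per step cancels the cubic growth, and the remaining 2^j is unbounded. *)
have [k0 k0P] : exists k0, 16 <= y ^+ (2 ^ k0).
  have [k0 k0P] := exnat (15 / (y - 1)).
  exists k0; apply: le_trans (bern _); rewrite ler_pdivrMr ?subr_gt0 // in k0P.
  have : k0%:R <= (2 ^ k0)%:R :> R by rewrite ler_nat ltnW // ltn_expl.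
  have : 0 < y - 1 by rewrite subr_gt0.
  by nra.
pose E := D * (2 ^ k0)%:R ^+ 3.
have EP j : 2 ^+ j <= E.
  have p8 : 0 < 8 ^+ j :> R by rewrite exprn_gt0.
  rewrite -(ler_pM2r p8).
  have -> : E * 8 ^+ j = D * (2 ^ (k0 + j))%:R ^+ 3.
    rewrite expnD natrM exprMn [in RHS]mulrA; congr (_ * _).
    by rewrite natrX -exprM mulnC exprM; congr (_ ^+ _); lra.
  apply: le_trans (yD _); rewrite -exprMn expnD exprM.
  have -> : 2 * 8 = 16 :> R by lra.
  apply: le_trans (_ : 16 ^+ (2 ^ j) <= _); first by rewrite ler_weXn2l ?ler1n // ltnW // ltn_expl.
  by rewrite lerXn2r ?nnegrE // exprn_ge0.
have [j jP] := exnat (E + 1).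
have h : j%:R <= 2 ^+ j :> R by rewrite -natrX ler_nat ltnW // ltn_expl.
by have := le_trans jP (le_trans h (EP j)); lra.
Qed.

Lemma powR_exprn (x r : R) n : 0 <= x -> (x `^ r) ^+ n = (x ^+ n) `^ r.
Proof.
move=> x_ge0; rewrite -(powR_mulrn n (powR_ge0 x r)) -(powR_mulrn n x_ge0).
by rewrite -!powRrM mulrC.
Qed.

(* The product of the construction with its two cyclic permutations has square
   blocks of side [n1 * n2 * n3]. *)
Lemma uniform_STPP_le p L m gT (G : {group gT}) (J : finType)
    (S T U : J -> {set gT}) (n1 n2 n3 : nat) eps :
  0 <= eps -> prime p -> host p L m G ->
  1 - (32 * (p ^ L)%:R)^-1 <= (p ^ m)%:R `^ (- eps) ->
  STPP G S T U ->
  (forall j, [/\ n1 <= #|S j|, n2 <= #|T j| & n3 <= #|U j|]%N) ->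
  #|J|%:R * (n1 * n2 * n3)%:R `^ (2 / 3) <= 3 * #|G|%:R `^ (1 - eps).
Proof.
move=> eps0 p_pr hostG mu_le stpp card_ge; set n := (n1 * n2 * n3)%N.
have host3 := host_prod (host_prod hostG hostG) hostG.
have [ws [card3 wsP hostle]] := host_square_le p_pr host3.
have rot1 := STPP_rot stpp; have rot2 := STPP_rot rot1.
have stpp3 := STPP_prod (STPP_prod stpp rot1) rot2.
have q_le : (3 * ((n + 2) %/ 3) <= n + 2)%N by rewrite mulnC leq_trunc_div.
have {hostle} := hostle _ _ _ _ n _ stpp3 _ q_le.
rewrite !card_prod /=.
have cardG3 : #|setX_group (setX_group G G) G| = (#|G| ^ 3)%N.
  by rewrite /= !cardsX !expnS expn0 muln1 mulnA.
rewrite {}cardG3 in card3 *.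
set q := ((n + 2) %/ 3)%N; set cnt := count_lt _ _ _.
move=> hostle; have {hostle} : (#|J| ^ 3 * q ^ 2 * p ^ size ws <= 3 * cnt * #|G| ^ 3)%N.
  have -> : (#|J| ^ 3 = #|J| * #|J| * #|J|)%N by rewrite !expnS expn0 muln1 mulnA.
  apply: hostle => -[[j1 j2] j3] /=.
  have [S1 T1 U1] := card_ge j1; have [S2 T2 U2] := card_ge j2; have [S3 T3 U3] := card_ge j3.
  rewrite !cardsX /n; split.
  - by rewrite !leq_mul.
  - by rewrite -mulnA mulnC !leq_mul.
  - by rewrite mulnC mulnA !leq_mul.
have p0 : 0 < p%:R :> R by rewrite ltr0n prime_gt0.
have M0 : (0 < p ^ L)%N by rewrite expn_gt0 prime_gt0.
have cnt_le := @count_lt_le R p (p ^ L) ws (prime_gt0 p_pr) M0 wsP.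
rewrite -/cnt exprMn in cnt_le; move: cnt_le; set mu := 1 - _ => cnt_le.
move=> le_cnt; rewrite -(ler_nat R) !natrM !natrX in le_cnt.
have g0 : 0 < #|G|%:R :> R by rewrite ltr0n cardG_gt0.
have qn : n%:R <= 3 * q%:R :> R.
  by rewrite -natrM ler_nat /q; lia.
have pn0 : 0 < p%:R ^+ size ws :> R by rewrite exprn_gt0.
(* 27 is the 9 from n <= 3 q times the 3 of [host_square_le]. *)
have le1 : #|J|%:R ^+ 3 * n%:R ^+ 2 <= 27 * (#|G|%:R ^+ 3 * mu ^+ size ws) :> R.
  rewrite -(ler_pM2r pn0).
  have h1 : n%:R ^+ 2 <= 9 * q%:R ^+ 2 :> R.
    have -> : 9 * q%:R ^+ 2 = (3 * q%:R) ^+ 2 :> R by ring.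
    by rewrite ler_pXn2r ?nnegrE ?mulr_ge0.
  apply: le_trans (_ : 9 * (#|J|%:R ^+ 3 * q%:R ^+ 2 * p%:R ^+ size ws) <= _).
    by rewrite [leRHS]mulrA ler_wpM2r ?(ltW pn0) // [leRHS]mulrCA ler_wpM2l ?exprn_ge0.
  apply: le_trans (ler_wpM2l _ le_cnt) _ => //.
  have : cnt%:R * #|G|%:R ^+ 3 <= p%:R ^+ size ws * mu ^+ size ws * #|G|%:R ^+ 3.
    by rewrite ler_wpM2r // exprn_ge0 // ltW.
  by lra.
have mu_ge0 : 0 <= mu.
  rewrite subr_ge0 invf_le1 -natrM ?ltr0n ?muln_gt0 ?M0 // ler1n muln_gt0 M0 //.
have le2 : mu ^+ size ws <= (#|G|%:R ^+ 3) `^ (- eps).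
  apply: le_trans (_ : ((p ^ m)%:R `^ (- eps)) ^+ size ws <= _).
    by rewrite lerXn2r ?nnegrE ?powR_ge0 // mu_ge0.
  rewrite powR_exprn // !powRN lef_pV2 ?posrE ?powR_gt0 ?exprn_gt0 //; last first.
    by rewrite ltr0n expn_gt0 prime_gt0.
  rewrite ge0_ler_powR ?nnegrE ?exprn_ge0 ?(ltW g0) //.
  by rewrite -!natrX ler_nat -expnM [(m * _)%N]mulnC.
rewrite -(@ler_pXn2r _ 3) ?nnegrE ?mulr_ge0 ?powR_ge0 //.
rewrite !exprMn !powR_exprn ?(ltW g0) //.
have -> : (n%:R ^+ 3) `^ (2 / 3) = n%:R ^+ 2 :> R.
  by rewrite -!powR_mulrn // -powRrM; congr (_ `^ _); field.
have -> : (#|G|%:R ^+ 3) `^ (1 - eps) = #|G|%:R ^+ 3 * (#|G|%:R ^+ 3) `^ (- eps).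
  by rewrite powRD ?powRr1 ?exprn_ge0 ?(ltW g0) // lt0r_neq0 ?implybT // exprn_gt0.
have -> : 3 ^+ 3 = 27 :> R by ring.
apply: le_trans le1 _; rewrite ler_wpM2l // ler_wpM2l // exprn_ge0 // ltW //.
Qed.

End RealEstimates.

(** * Arbitrary constructions by dyadic sorting and tensor powers *)

Section STPPValue.

Variable R : realType.

Definition STPP_value (gT : finGroupType) (I : finType) (S T U : I -> {set gT}) : R :=
  \sum_(i : I) (#|S i| * #|T i| * #|U i|)%:R `^ (2 / 3).

Lemma STPP_value_prod (gT hT : finGroupType) (I J : finType)
    (S T U : I -> {set gT}) (S' T' U' : J -> {set hT}) :
  STPP_value (fun ij : I * J => setX (S ij.1) (S' ij.2))
    (fun ij => setX (T ij.1) (T' ij.2)) (fun ij => setX (U ij.1) (U' ij.2)) =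
  STPP_value S T U * STPP_value S' T' U'.
Proof.
rewrite /STPP_value mulr_suml (eq_bigr (fun i : I => \sum_(j : J)
  (#|S i| * #|T i| * #|U i|)%:R `^ (2 / 3) * (#|S' j| * #|T' j| * #|U' j|)%:R `^ (2 / 3))).
  rewrite pair_big /=; apply: eq_bigr => -[i j] _ /=.
  by rewrite -powRM // -natrM !cardsX; congr (_%:R `^ _); rewrite !(mulnACA _ #|S' j|) mulnACA.
by move=> i _; rewrite mulr_sumr.
Qed.

Variables (eps : R) (p L m : nat).
Hypothesis eps_ge0 : 0 <= eps.
Hypothesis p_pr : prime p.
Hypothesis eps_le : 1 - (32 * (p ^ L)%:R)^-1 <= (p ^ m)%:R `^ (- eps).

(** Each class of blocks with the same dyadic side lengths is handled by [uniform_STPP_le]. Rounding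
    the sides costs 8^(2/3) = 4, whence 12 = 4 * 3 for each class. *)
Lemma STPP_value_log (gT : finGroupType) (G : {group gT}) (I : finType)
    (S T U : I -> {set gT}) :
  host p L m G -> STPP G S T U ->
  STPP_value S T U <= 12 * (trunc_log 2 #|G|).+1%:R ^+ 3 * #|G|%:R `^ (1 - eps).
Proof.
move=> hostG stpp; set N := trunc_log 2 #|G|.
pose key i : 'I_N.+1 * 'I_N.+1 * 'I_N.+1 :=
  (inord (trunc_log 2 #|S i|), inord (trunc_log 2 #|T i|), inord (trunc_log 2 #|U i|)).
rewrite /STPP_value (partition_big key xpredT) //=.
have -> : 12 * N.+1%:R ^+ 3 * #|G|%:R `^ (1 - eps) =
    \sum_(k : 'I_N.+1 * 'I_N.+1 * 'I_N.+1) 12 * #|G|%:R `^ (1 - eps).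
  rewrite sumr_const !card_prod !card_ord -[RHS]mulr_natl !natrM.
  by ring.
apply: ler_sum => -[[k1 k2] k3] _.
(* An empty side gets logarithm 0 like a singleton; blocks with one contribute 0 and are removed. *)
pose P i := [&& key i == (k1, k2, k3), #|S i| != 0, #|T i| != 0 & #|U i| != 0]%N.
pose J := {i : I | P i}.
have subG i : [/\ #|S i| <= #|G|, #|T i| <= #|G| & #|U i| <= #|G|]%N.
  by have [? ? ?] := STPP_subset stpp i; split; apply: subset_leq_card.
have logP a k : a != 0%N -> (a <= #|G|)%N -> inord (trunc_log 2 a) = k :> 'I_N.+1 ->
    (2 ^ k <= a <= 2 * 2 ^ k)%N.
  move=> a0 aG <-; rewrite inordK ?ltnS ?leq_trunc_log // -expnS.
  by rewrite trunc_logP ?lt0n //= ltnW // trunc_log_ltn.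
have keyP i : P i -> [/\ (2 ^ k1 <= #|S i| <= 2 * 2 ^ k1)%N,
    (2 ^ k2 <= #|T i| <= 2 * 2 ^ k2)%N & (2 ^ k3 <= #|U i| <= 2 * 2 ^ k3)%N].
  have [? ? ?] := subG i.
  by case/and4P=> /eqP[E1 E2 E3] ? ? ?; split; apply: logP.
set n := (2 ^ k1 * 2 ^ k2 * 2 ^ k3)%N.
have leJ : #|{: J}|%:R * n%:R `^ (2 / 3) <= 3 * #|G|%:R `^ (1 - eps) :> R.
  apply: (uniform_STPP_le eps_ge0 p_pr hostG eps_le (STPP_comp (@val_inj _ _ J) stpp)).
  by move=> [i /= /keyP[/andP[-> _] /andP[-> _] /andP[-> _]]].
apply: le_trans (_ : 4 * (#|{: J}|%:R * n%:R `^ (2 / 3)) <= _); last by lra.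
rewrite (bigID (fun i => [&& #|S i| != 0, #|T i| != 0 & #|U i| != 0]%N)) /=.
rewrite [X in _ + X]big1 ?addr0 => [|i /andP[_]]; last first.
  rewrite !negb_and !negbK orbA -!muln_eq0 => /eqP ->.
  by rewrite powR0.
have -> : 4 * (#|{: J}|%:R * n%:R `^ (2 / 3)) =
    \sum_(i in [pred i | P i]) (4 * n%:R `^ (2 / 3)) :> R.
  by rewrite sumr_const -[RHS]mulr_natl card_sig mulrCA.
apply: ler_sum => i /keyP[/andP[_ a2] /andP[_ b2] /andP[_ c2]].
have -> : 4 = 8 `^ (2 / 3) :> R.
  have -> : 8 = 2 `^ 3 :> R by rewrite powR_mulrn // -natrX.
  rewrite -powRrM (_ : 3 * (2 / 3) = 2%:R :> R) ?powR_mulrn //; last by field.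
  by rewrite -natrX.
rewrite -powRM // -natrM ge0_ler_powR ?nnegrE // ler_nat /n.
by apply: leq_trans (leq_mul (leq_mul a2 b2) c2) _; lia.
Qed.

Lemma STPP_value_pow k (gT : finGroupType) (G : {group gT}) (I : finType)
    (S T U : I -> {set gT}) :
  host p L m G -> STPP G S T U ->
  STPP_value S T U ^+ (2 ^ k) <=
    12 * (trunc_log 2 (#|G| ^ (2 ^ k))).+1%:R ^+ 3 * (#|G|%:R `^ (1 - eps)) ^+ (2 ^ k).
Proof.
elim: k gT G I S T U => [|k IHk] gT G I S T U hostG stpp.
  by rewrite expn0 expn1 !expr1; apply: STPP_value_log.
have := IHk _ _ _ _ _ _ (host_prod hostG hostG) (STPP_prod stpp stpp).
rewrite STPP_value_prod /= cardsX natrM powRM // -!expr2 -!exprM.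
by rewrite mulnn -expnM -expnS.
Qed.

(** Tensor power trick: the value is multiplicative while the loss in G^(2^k) is cubic in 2^k, so
    [le1_of_pow2_growth] removes it. *)
Lemma STPP_value_le (gT : finGroupType) (G : {group gT}) (I : finType)
    (S T U : I -> {set gT}) :
  host p L m G -> STPP G S T U -> STPP_value S T U <= #|G|%:R `^ (1 - eps).
Proof.
move=> hostG stpp; have G0 : 0 < #|G|%:R :> R by rewrite ltr0n cardG_gt0.
set g := _ `^ _; have g0 : 0 < g by apply: powR_gt0.
rewrite -[g]mul1r -ler_pdivrMr //.
apply: (@le1_of_pow2_growth R _ (12 * (#|G|.+1)%:R ^+ 3)).
  by rewrite divr_ge0 ?(ltW g0) // sumr_ge0 // => i _; apply: powR_ge0.
move=> k; rewrite expr_div_n ler_pdivrMr ?exprn_gt0 //.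
apply: le_trans (STPP_value_pow k hostG stpp) _.
rewrite ler_wpM2r ?exprn_ge0 ?(ltW g0) // -mulrA ler_wpM2l // -exprMn.
rewrite lerXn2r ?nnegrE ?mulr_ge0 // -natrM ler_nat.
have -> : (#|G|.+1 * 2 ^ k = #|G| * 2 ^ k + 2 ^ k)%N by rewrite mulSn addnC.
apply: (@leq_trans (#|G| * 2 ^ k).+1); last by rewrite -addn1 leq_add2l expn_gt0.
rewrite ltnS -[leqRHS](@trunc_expnK 2) //; apply: leq_trunc_log.
by rewrite expnM leq_exp2r ?expn_gt0 // ltnW // ltn_expl.
Qed.

End STPPValue.

Lemma sum_irr_dim2 (gT : finGroupType) (G : {group gT}) :
  (\sum_(j : Iirr G) irr_dim j ^ 2 = #|G|)%N.
Proof.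
apply/eqP; rewrite -(eqr_nat algC) -irr_sum_square natr_sum; apply/eqP.
by apply: eq_bigr => j _; rewrite natrX irr1_degree.
Qed.

(** Since exp(-z) >= 1 - z and ln(p^m) <= p^m <= (m + 1)^m, it suffices that eps (m + 1)^m <= 1 /
    (32 (m + 1)^L); eps is chosen to give equality. *)
Lemma exists_exponent_gain (R : realType) (m L : nat) :
  exists2 eps : R, 0 < eps <= 1 & forall p : nat, prime p -> (p <= m.+1)%N ->
    1 - (32 * (p ^ L)%:R)^-1 <= (p ^ m)%:R `^ (- eps).
Proof.
pose M : R := (m.+1 ^ L)%:R; pose q : R := (m.+1 ^ m)%:R.
have M1 : 1 <= M by rewrite ler1n expn_gt0.
have q1 : 1 <= q by rewrite ler1n expn_gt0.
have D0 : 0 < 32 * M * q by nra.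
exists (32 * M * q)^-1.
  by rewrite invr_gt0 D0 invf_le1 //; nra.
move=> p p_pr le_pm; have p_gt0 := prime_gt0 p_pr.
have le_exp e : (p ^ e)%:R <= (m.+1 ^ e)%:R :> R.
  by rewrite ler_nat; case: e => // e; rewrite leq_exp2r.
have pm0 : 0 < (p ^ m)%:R :> R by rewrite ltr0n expn_gt0 p_gt0.
have pL0 : 0 < (p ^ L)%:R :> R by rewrite ltr0n expn_gt0 p_gt0.
rewrite /powR gt_eqF //; apply: le_trans (expR_ge1Dx _).
rewrite lerD2l mulNr lerN2.
apply: le_trans (_ : (32 * M * q)^-1 * q <= _).
  rewrite ler_wpM2l ?invr_ge0 ?(ltW D0) //.
  by apply: le_trans (le_exp m); apply: ltW; apply: ln_sublinear.
rewrite invfM mulfVK ?gt_eqF ?(lt_le_trans ltr01) //.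
have leM := le_exp L; rewrite -/M in leM.
by rewrite lef_pV2 ?posrE; lra.
Qed.

Theorem corollary3p20 (R : realType)
    (family : forall gT : finGroupType, {group gT} -> Prop) (m c : nat)
    (family_bounded : forall (gT : finGroupType) (G : {group gT}),
       family gT G ->
       [/\ nilpotent G, (exponent G <= m)%N & (nil_class G <= c)%N]) :
  exists tau : R, 2 < tau <= 3 /\
    forall (gT : finGroupType) (G : {group gT}), family gT G ->
    forall (I : finType) (S T U : I -> {set gT}), STPP G S T U ->
      \sum_(i : I) ((#|S i| * #|T i| * #|U i|)%N%:R `^ (tau / 3))
        <= \sum_(j : Iirr G) ((irr_dim j)%:R `^ tau).
Proof.
have [eps /andP[eps0 eps1] epsP] := exists_exponent_gain R m (c * m).
exists (2 + eps); split; first by lra.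
move=> gT G famG I S T U stpp.
have [nilG expG classG] := family_bounded gT G famG.
have [p [p_pr le_pm hostG]] := nilpotent_host nilG expG classG.
have vG := STPP_value_le (ltW eps0) p_pr (epsP p p_pr le_pm) hostG stpp.
have G0 : 0 < #|G|%:R :> R by rewrite ltr0n cardG_gt0.
have G1 : 1 <= #|G|%:R :> R by rewrite ler1n cardG_gt0.
(* Both sides are compared with |G| = sum_j d_j^2, where d_j >= 1 allows raising the exponent to
   tau. *)
apply: le_trans (_ : #|G|%:R <= _); last first.
  rewrite -[in leLHS](sum_irr_dim2 G) natr_sum; apply: ler_sum => j _.
  rewrite natrX -powR_mulrn // ler_powR ?ler1n ?irr_degree_gt0 //.
  by rewrite lerDl ltW.
(* Blockwise, the surplus factor (|S_i||T_i||U_i|)^(eps/3) is at most |G|^eps, exactly what the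
   bound |G|^(1 - eps) on the value can afford. *)
apply: le_trans (_ : #|G|%:R `^ eps * STPP_value R S T U <= _); last first.
  apply: le_trans (ler_wpM2l (powR_ge0 _ _) vG) _.
  rewrite -powRD; last by rewrite (gt_eqF G0) implybT.
  by rewrite (_ : eps + (1 - eps) = 1) ?powRr1 ?(ltW G0) //; ring.
rewrite mulr_sumr; apply: ler_sum => i _.
set abc := (_ * _ * _)%N; have [-> | abc0] := posnP abc.
  by rewrite !powR0 ?mulr0 //; apply: lt0r_neq0; lra.
have abcG : (abc <= #|G| ^ 3)%N.
  have [Si Ti Ui] := STPP_subset stpp i.
  by rewrite !expnS expn0 muln1 mulnA !leq_mul // subset_leq_card.
have -> : (2 + eps) / 3 = eps / 3 + 2 / 3 by rewrite mulrDl addrC.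
rewrite powRD; last by rewrite pnatr_eq0 -lt0n abc0 implybT.
rewrite ler_wpM2r ?powR_ge0 //.
apply: le_trans (_ : (#|G| ^ 3)%:R `^ (eps / 3) <= _).
  by rewrite ge0_ler_powR ?nnegrE ?ler_nat // divr_ge0 // ltW.
rewrite natrX -powR_mulrn ?(ltW G0) // -powRrM mulrCA divff ?mulr1 //.
Qed.
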